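(* Let $\mathbf S$ be a category with finite products and $\mathscr V$ an $\mathbf S$-indexed monoidal category. The (non-full) inclusion 2-functor $\mathscr V\text{-}\mathcal{FIB}\hookrightarrow\mathscr V\text{-}\mathrm{CAT}$ has a right 2-adjoint $\Gamma$; that is, for a $\mathscr V$-fibration $\mathscr A$ and a large $\mathscr V$-category $\mathscr B$ there are natural isomorphisms of hom-categories $$\mathscr V\text{-}\mathcal{FIB}(\mathscr A,\Gamma\mathscr B)\cong\mathscr V\text{-}\mathrm{CAT}(\mathscr A,\mathscr B).$$ Moreover, the unit $\mathscr A\to\Gamma\mathscr A$ and counit $\Gamma\mathscr B\to\mathscr B$ are internal equivalences, so this 2-adjunction is actually a biequivalence.
   Context: An $\mathbf S$-indexed monoidal category $\mathscr V$ is a pseudofunctor $\mathbf S^{\mathrm{op}}\to\mathrm{MonCat}$ (strong monoidal functors, monoidal transformations), $X\mapsto(\mathscr V^X,\otimes_X,\mathbb I_X)$, $f\mapsto f^*$. A morphism $M\to N$ ''over'' $f:X\to Y$ ($M\in\mathscr V^X$, $N\in\mathscr V^Y$) means a morphism $M\to f^*N$ in $\mathscr V^X$. For $M\in\mathscr V^{X\times Y}$, $N\in\mathscr V^{Y\times Z}$, $M\otimes_YN\in\mathscr V^{X\times Y\times Z}$ is the $\otimes_{X\times Y\times Z}$-product of the pullbacks of $M,N$ along the projections. A large $\mathscr V$-category $\mathscr A$ has a collection of objects, each $x$ with an extent $\epsilon x\in\mathbf S$; hom-objects $\mathscr A(x,y)\in\mathscr V^{\epsilon y\times\epsilon x}$;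 identities $\mathbb I_{\epsilon x}\to\mathscr A(x,x)$ over the diagonal; compositions $\mathscr A(y,z)\otimes_{\epsilon y}\mathscr A(x,y)\to\mathscr A(x,z)$ over the projection $\epsilon z\times\epsilon y\times\epsilon x\to\epsilon z\times\epsilon x$; associative and unital. A $\mathscr V$-functor $f:\mathscr A\to\mathscr B$ assigns to each $x$ an object $fx$ and a morphism $\epsilon f_x:\epsilon x\to\epsilon(fx)$ in $\mathbf S$, with morphisms $\mathscr A(x,y)\to\mathscr B(fx,fy)$ over $\epsilon f_y\times\epsilon f_x$ preserving identities and composition; it is called indexed if every $\epsilon f_x$ is an identity. A $\mathscr V$-natural transformation $f\to g$ consists of morphisms $\mathbb I_{\epsilon x}\to\mathscr B(fx,gx)$ over $(\epsilon g_x,\epsilon f_x)$ satisfying the usual naturality square. These form the 2-category $\mathscr V\text{-}\mathrm{CAT}$. For an object $x$ of $\mathscr A$ and $f:Y\to\epsilon x$ in $\mathbf S$, a restriction of $x$ along $f$ is an object $f^*x$ with $\epsilon(f^*x)=Y$ together with morphisms $\mathbb I_Y\to\mathscr A(f^*x,x)$ over $(f,1_Y)$ and $\mathbb I_Y\to\mathscr A(x,f^*x)$ over $(1_Y,f)$ that are mutually inverse under composition (their composites are the identity of $f^*x$ and the pullback along $f$ of the identity of $x$). A $\mathscr V$-fibration is a large $\mathscr V$-category in which all restrictions exist. $\mathscr V\text{-}\mathcal{FIB}$ is the sub-2-category of $\mathscr V\text{-}\mathrm{CAT}$ consisting of the $\mathscr V$-fibrations, the indexed $\mathscr V$-functors between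 them, and all $\mathscr V$-natural transformations between those. *)

(* Defs.v *)
From Corelib Require Import ssreflect.
From Stdlib Require Import FunctionalExtensionality ProofIrrelevance.

Set Implicit Arguments.
Unset Strict Implicit.
Unset Printing Implicit Defensive.

Record Category : Type := MkCategory {
  ob :> Type;
  hom : ob -> ob -> Type;
  idm : forall a, hom a a;
  cmp : forall a b c, hom b c -> hom a b -> hom a c;
  cmp_assoc : forall a b c d (h : hom c d) (g : hom b c) (f : hom a b),
    cmp h (cmp g f) = cmp (cmp h g) f;
  cmp_idl : forall a b (f : hom a b), cmp (idm b) f = f;
  cmp_idr : forall a b (f : hom a b), cmp f (idm a) = f }.
Arguments hom {c} a b : rename.
Arguments idm {c} a : rename.
Arguments cmp {c a b c0} g f : rename.
Notation "g ∘ f" := (cmp g f) (at level 40, left associativity).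

Lemma cmp_l {C : Category} {a b c d : C} {g : hom b c} {f : hom a b} {k : hom a c}
  (e : g ∘ f = k) (x : hom d a) : g ∘ (f ∘ x) = k ∘ x.
Proof. by rewrite cmp_assoc e. Qed.

(** Equality of arrows whose end points are equal, but not judgmentally so. *)
Inductive HomEq {C : Category} {a b : C} (f : hom a b) :
  forall {c d : C}, hom c d -> Prop :=
| HomEq_refl : HomEq f f.

(** [f : a -> b] is an identity: [b] equals [a], and along this [f] is [idm a]. *)
Inductive IsIdentity {C : Category} {a : C} : forall {b : C}, hom a b -> Prop :=
| IsIdentity_idm : IsIdentity (idm a).

Record Iso {C : Category} (a b : C) : Type := MkIso {
  fwd : hom a b;
  bwd : hom b a;
  bwd_fwd : bwd ∘ fwd = idm a;
  fwd_bwd : fwd ∘ bwd = idm b }.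

Definition iso_id {C : Category} (a : C) : Iso a a :=
  MkIso (cmp_idl (idm a)) (cmp_idl (idm a)).

Definition iso_comp {C : Category} {a b c : C} (g : Iso b c) (f : Iso a b) : Iso a c.
Proof.
  refine (@MkIso C a c (fwd g ∘ fwd f) (bwd f ∘ bwd g) _ _).
  - by rewrite -cmp_assoc (cmp_l (bwd_fwd g)) cmp_idl bwd_fwd.
  - by rewrite -cmp_assoc (cmp_l (fwd_bwd f)) cmp_idl fwd_bwd.
Defined.

Record Functor (C D : Category) : Type := MkFunctor {
  fobj :> C -> D;
  fmap : forall a b : C, hom a b -> hom (fobj a) (fobj b);
  fmap_id : forall a, fmap (idm a) = idm (fobj a);
  fmap_cmp : forall (a b c : C) (g : hom b c) (f : hom a b),
    fmap (g ∘ f) = fmap g ∘ fmap f }.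
Arguments fmap {C D} f {a b} _ : rename.

Definition functor_id (C : Category) : Functor C C :=
  @MkFunctor C C (fun a => a) (fun a b f => f) (fun a => eq_refl) (fun a b c g f => eq_refl).

Definition functor_comp {C D E : Category} (G : Functor D E) (F : Functor C D) : Functor C E.
Proof.
  refine (@MkFunctor C E (fun a => G (F a)) (fun a b f => fmap G (fmap F f)) _ _).
  - by move=> a; rewrite !fmap_id.
  - by move=> a b c g f; rewrite !fmap_cmp.
Defined.

Definition iso_map {C D : Category} (F : Functor C D) {a b : C} (i : Iso a b) : Iso (F a) (F b).
Proof.
  refine (@MkIso D _ _ (fmap F (fwd i)) (fmap F (bwd i)) _ _).
  - by rewrite -fmap_cmp bwd_fwd fmap_id.
  - by rewrite -fmap_cmp fwd_bwd fmap_id.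
Defined.

(** Only invertible transformations are needed for pseudofunctors. *)
Record NatIso {C D : Category} (F G : Functor C D) : Type := MkNatIso {
  ni_iso : forall a, Iso (F a) (G a);
  ni_nat : forall (a b : C) (f : hom a b),
    fwd (ni_iso b) ∘ fmap F f = fmap G f ∘ fwd (ni_iso a) }.

Record IsoOfCategories (C D : Category) : Type := MkIsoOfCategories {
  ioc_to : Functor C D;
  ioc_from : Functor D C;
  ioc_from_to : functor_comp ioc_from ioc_to = functor_id C;
  ioc_to_from : functor_comp ioc_to ioc_from = functor_id D }.

Definition full_subcategory (C : Category) (P : C -> Prop) : Category :=
  @MkCategory {a : C | P a}
    (fun a b => hom (proj1_sig a) (proj1_sig b))
    (fun a => idm (proj1_sig a))
    (fun a b c g f => g ∘ f)
    (fun a b c d h g f => cmp_assoc h g f)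
    (fun a b f => cmp_idl f)
    (fun a b f => cmp_idr f).

(** Finite products are chosen: a terminal object and binary products. *)
Record FinProdCategory : Type := MkFinProdCategory {
  fp_cat :> Category;
  terminal : fp_cat;
  to_terminal : forall X : fp_cat, hom X terminal;
  to_terminal_unique : forall (X : fp_cat) (f : hom X terminal), f = to_terminal X;
  prd : fp_cat -> fp_cat -> fp_cat;
  pr1 : forall X Y, hom (prd X Y) X;
  pr2 : forall X Y, hom (prd X Y) Y;
  pair : forall T X Y : fp_cat, hom T X -> hom T Y -> hom T (prd X Y);
  pr1_pair : forall (T X Y : fp_cat) (f : hom T X) (g : hom T Y), pr1 X Y ∘ pair f g = f;
  pr2_pair : forall (T X Y : fp_cat) (f : hom T X) (g : hom T Y), pr2 X Y ∘ pair f g = g;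
  pair_unique : forall (T X Y : fp_cat) (h : hom T (prd X Y)),
    h = pair (pr1 X Y ∘ h) (pr2 X Y ∘ h) }.
Arguments terminal {f} : rename.
Arguments prd {f} X Y : rename.
Arguments pr1 {f X Y} : rename.
Arguments pr2 {f X Y} : rename.
Arguments pair {f T X Y} _ _ : rename.
Notation "X × Y" := (prd X Y) (at level 41, right associativity).

Section Products.
Context {S : FinProdCategory}.

Lemma pair_cmp {T' T X Y : S} (f : hom T X) (g : hom T Y) (u : hom T' T) :
  pair f g ∘ u = pair (f ∘ u) (g ∘ u).
Proof.
  by rewrite (pair_unique (pair f g ∘ u)) !cmp_assoc pr1_pair pr2_pair.
Qed.

Lemma pair_inj {T X Y : S} (f f' : hom T X) (g g' : hom T Y) :
  pair f g = pair f' g' -> f = f' /\ g = g'.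
Proof.
  move=> e; split.
  - by rewrite -(pr1_pair f g) e pr1_pair.
  - by rewrite -(pr2_pair f g) e pr2_pair.
Qed.

Definition diag (X : S) : hom X (X × X) := pair (idm X) (idm X).

Definition prdm {X X' Y Y' : S} (f : hom X X') (g : hom Y Y') : hom (X × Y) (X' × Y') :=
  pair (f ∘ pr1) (g ∘ pr2).

Lemma prdm_pair {T X X' Y Y' : S} (f : hom X X') (g : hom Y Y') (a : hom T X) (b : hom T Y) :
  prdm f g ∘ pair a b = pair (f ∘ a) (g ∘ b).
Proof.
  by rewrite /prdm pair_cmp -!cmp_assoc pr1_pair pr2_pair.
Qed.

Lemma diag_cmp {T X : S} (a : hom T X) : diag X ∘ a = pair a a.
Proof. by rewrite /diag pair_cmp !cmp_idl. Qed.

Definition pr12 {X Y Z : S} : hom (X × Y × Z) (X × Y) := pair pr1 (pr1 ∘ pr2).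
Definition pr23 {X Y Z : S} : hom (X × Y × Z) (Y × Z) := pair (pr1 ∘ pr2) (pr2 ∘ pr2).
Definition pr13 {X Y Z : S} : hom (X × Y × Z) (X × Z) := pair pr1 (pr2 ∘ pr2).

Definition triple {T X Y Z : S} (a : hom T X) (b : hom T Y) (c : hom T Z) :
  hom T (X × Y × Z) := pair a (pair b c).

Lemma pr12_triple {T X Y Z : S} (a : hom T X) (b : hom T Y) (c : hom T Z) :
  pr12 ∘ triple a b c = pair a b.
Proof. by rewrite /pr12 /triple pair_cmp -cmp_assoc pr1_pair pr2_pair pr1_pair. Qed.

Lemma pr23_triple {T X Y Z : S} (a : hom T X) (b : hom T Y) (c : hom T Z) :
  pr23 ∘ triple a b c = pair b c.
Proof. by rewrite /pr23 /triple pair_cmp -!cmp_assoc !pr2_pair pr1_pair. Qed.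

Lemma pr13_triple {T X Y Z : S} (a : hom T X) (b : hom T Y) (c : hom T Z) :
  pr13 ∘ triple a b c = pair a c.
Proof. by rewrite /pr13 /triple pair_cmp -cmp_assoc pr1_pair !pr2_pair. Qed.

Lemma triple_cmp {T' T X Y Z : S} (a : hom T X) (b : hom T Y) (c : hom T Z) (u : hom T' T) :
  triple a b c ∘ u = triple (a ∘ u) (b ∘ u) (c ∘ u).
Proof. by rewrite /triple !pair_cmp. Qed.
End Products.

Record MonoidalCategory : Type := MkMonoidalCategory {
  mon_cat :> Category;
  tens : mon_cat -> mon_cat -> mon_cat;
  tensm : forall a a' b b' : mon_cat, hom a a' -> hom b b' -> hom (tens a b) (tens a' b');
  tens_id : forall a b, tensm (idm a) (idm b) = idm (tens a b);
  tens_cmp : forall (a a' a'' b b' b'' : mon_cat)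
      (f' : hom a' a'') (f : hom a a') (g' : hom b' b'') (g : hom b b'),
    tensm (f' ∘ f) (g' ∘ g) = tensm f' g' ∘ tensm f g;
  unt : mon_cat;
  assoc : forall a b c, Iso (tens (tens a b) c) (tens a (tens b c));
  lunit : forall a, Iso (tens unt a) a;
  runit : forall a, Iso (tens a unt) a;
  assoc_nat : forall (a a' b b' c c' : mon_cat) (f : hom a a') (g : hom b b') (h : hom c c'),
    fwd (assoc a' b' c') ∘ tensm (tensm f g) h = tensm f (tensm g h) ∘ fwd (assoc a b c);
  lunit_nat : forall (a a' : mon_cat) (f : hom a a'),
    fwd (lunit a') ∘ tensm (idm unt) f = f ∘ fwd (lunit a);
  runit_nat : forall (a a' : mon_cat) (f : hom a a'),
    fwd (runit a') ∘ tensm f (idm unt) = f ∘ fwd (runit a);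
  pentagon : forall a b c d,
    fwd (assoc a b (tens c d)) ∘ fwd (assoc (tens a b) c d)
    = tensm (idm a) (fwd (assoc b c d)) ∘ fwd (assoc a (tens b c) d)
        ∘ tensm (fwd (assoc a b c)) (idm d);
  triangle : forall a b,
    tensm (idm a) (fwd (lunit b)) ∘ fwd (assoc a unt b) = tensm (fwd (runit a)) (idm b) }.
Arguments tens {m} a b : rename.
Arguments tensm {m a a' b b'} f g : rename.
Arguments unt {m} : rename.
Arguments assoc {m} a b c : rename.
Arguments lunit {m} a : rename.
Arguments runit {m} a : rename.
Notation "a ⊗ b" := (tens a b) (at level 37, left associativity).
Notation "f ⊠ g" := (tensm f g) (at level 37, left associativity).

Section Isos.
Context {C : Category}.
Lemma iso_epi {a b c : C} (i : Iso a b) (f g : hom b c) : f ∘ fwd i = g ∘ fwd i -> f = g.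
Proof.
  move=> e; by rewrite -(cmp_idr f) -(cmp_idr g) -(fwd_bwd i) !cmp_assoc e.
Qed.
Lemma iso_mono {a b c : C} (i : Iso b c) (f g : hom a b) : fwd i ∘ f = fwd i ∘ g -> f = g.
Proof.
  move=> e; by rewrite -(cmp_idl f) -(cmp_idl g) -(bwd_fwd i) -!cmp_assoc e.
Qed.
End Isos.
Arguments iso_epi {C a b c} i [f g] _.
Arguments iso_mono {C a b c} i [f g] _.

Section MonoidalCoherence.
Context {M : MonoidalCategory}.
Implicit Types a b c : M.

Definition iso_tens {a a' b b' : M} (i : Iso a a') (j : Iso b b') : Iso (a ⊗ b) (a' ⊗ b').
Proof.
  refine (@MkIso M _ _ (fwd i ⊠ fwd j) (bwd i ⊠ bwd j) _ _).
  - by rewrite -tens_cmp !bwd_fwd tens_id.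
  - by rewrite -tens_cmp !fwd_bwd tens_id.
Defined.

Lemma tens_idl_cmp {a b c d : M} (g : hom b c) (f : hom a b) :
  idm d ⊠ (g ∘ f) = (idm d ⊠ g) ∘ (idm d ⊠ f).
Proof. by rewrite -tens_cmp cmp_idl. Qed.
Lemma tens_idr_cmp {a b c d : M} (g : hom b c) (f : hom a b) :
  (g ∘ f) ⊠ idm d = (g ⊠ idm d) ∘ (f ⊠ idm d).
Proof. by rewrite -tens_cmp cmp_idl. Qed.

Lemma tens_faithful_l a b (f g : hom a b) : idm unt ⊠ f = idm unt ⊠ g -> f = g.
Proof.
  move=> e; apply: (iso_epi (lunit a)); by rewrite -!lunit_nat e.
Qed.
Lemma tens_faithful_r a b (f g : hom a b) : f ⊠ idm unt = g ⊠ idm unt -> f = g.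
Proof.
  move=> e; apply: (iso_epi (runit a)); by rewrite -!runit_nat e.
Qed.

Lemma lunit_tens a b :
  fwd (lunit (a ⊗ b)) ∘ fwd (assoc unt a b) = fwd (lunit a) ⊠ idm b.
Proof.
  apply: tens_faithful_l.
  apply: (iso_epi (assoc unt (unt ⊗ a) b)).
  apply: (iso_epi (iso_tens (assoc unt unt a) (iso_id b))) => /=.
  rewrite tens_idl_cmp -!cmp_assoc.
  have p := pentagon unt unt a b; rewrite -cmp_assoc in p; rewrite -p => {p}.
  rewrite cmp_assoc triangle -(tens_id a b) -assoc_nat -triangle tens_idr_cmp.
  by rewrite cmp_assoc assoc_nat -!cmp_assoc.
Qed.

Lemma lunit_runit : fwd (lunit unt) = fwd (runit (unt : M)).
Proof.
  apply: tens_faithful_r.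
  rewrite -triangle -lunit_tens; congr (_ ∘ _).
  by apply: (iso_mono (lunit unt)); rewrite lunit_nat.
Qed.

Lemma lunit_runit_bwd : bwd (lunit unt) = bwd (runit (unt : M)).
Proof.
  apply: (iso_mono (lunit unt)); by rewrite {2}lunit_runit !fwd_bwd.
Qed.

Lemma lunit_nat_bwd (a a' : M) (f : hom a a') :
  (idm unt ⊠ f) ∘ bwd (lunit a) = bwd (lunit a') ∘ f.
Proof.
  apply: (iso_mono (lunit a')).
  by rewrite cmp_assoc lunit_nat -cmp_assoc fwd_bwd cmp_assoc fwd_bwd cmp_idl cmp_idr.
Qed.
Lemma runit_nat_bwd (a a' : M) (f : hom a a') :
  (f ⊠ idm unt) ∘ bwd (runit a) = bwd (runit a') ∘ f.
Proof.
  apply: (iso_mono (runit a')).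
  by rewrite cmp_assoc runit_nat -cmp_assoc fwd_bwd cmp_assoc fwd_bwd cmp_idl cmp_idr.
Qed.

Lemma triangle_bwd a b :
  fwd (assoc a unt b) ∘ (bwd (runit a) ⊠ idm b) = idm a ⊠ bwd (lunit b).
Proof.
  apply: (iso_mono (iso_tens (iso_id a) (lunit b))) => /=.
  by rewrite cmp_assoc triangle -!tens_cmp !fwd_bwd !cmp_idl.
Qed.
Lemma lunit_tens_bwd a b :
  fwd (assoc unt a b) ∘ (bwd (lunit a) ⊠ idm b) = bwd (lunit (a ⊗ b)).
Proof.
  apply: (iso_mono (lunit (a ⊗ b))).
  by rewrite cmp_assoc lunit_tens -tens_cmp !fwd_bwd cmp_idl tens_id.
Qed.
End MonoidalCoherence.

Record StrongMonoidalFunctor (A B : MonoidalCategory) : Type := MkStrongMonoidalFunctor {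
  smf_functor :> Functor A B;
  smf_tens : forall a b : A, Iso (smf_functor a ⊗ smf_functor b) (smf_functor (a ⊗ b));
  smf_unit : Iso unt (smf_functor unt);
  smf_tens_nat : forall (a a' b b' : A) (f : hom a a') (g : hom b b'),
    fwd (smf_tens a' b') ∘ (fmap smf_functor f ⊠ fmap smf_functor g)
    = fmap smf_functor (f ⊠ g) ∘ fwd (smf_tens a b);
  smf_assoc : forall a b c : A,
    fmap smf_functor (fwd (assoc a b c)) ∘ fwd (smf_tens (a ⊗ b) c)
      ∘ (fwd (smf_tens a b) ⊠ idm (smf_functor c))
    = fwd (smf_tens a (b ⊗ c)) ∘ (idm (smf_functor a) ⊠ fwd (smf_tens b c))
      ∘ fwd (assoc (smf_functor a) (smf_functor b) (smf_functor c));
  smf_lunit : forall a : A,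
    fmap smf_functor (fwd (lunit a)) ∘ fwd (smf_tens unt a)
      ∘ (fwd smf_unit ⊠ idm (smf_functor a))
    = fwd (lunit (smf_functor a));
  smf_runit : forall a : A,
    fmap smf_functor (fwd (runit a)) ∘ fwd (smf_tens a unt)
      ∘ (idm (smf_functor a) ⊠ fwd smf_unit)
    = fwd (runit (smf_functor a)) }.

Definition smf_id (A : MonoidalCategory) : StrongMonoidalFunctor A A.
Proof.
  refine (@MkStrongMonoidalFunctor A A (functor_id A)
            (fun a b => iso_id (a ⊗ b)) (iso_id unt) _ _ _ _) => /=.
  - by move=> *; rewrite cmp_idl cmp_idr.
  - by move=> a b c; rewrite !tens_id !cmp_idr !cmp_idl.
  - by move=> a; rewrite !tens_id !cmp_idr.
  - by move=> a; rewrite !tens_id !cmp_idr.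
Defined.

Definition smf_comp {A B C : MonoidalCategory}
  (G : StrongMonoidalFunctor B C) (F : StrongMonoidalFunctor A B) :
  StrongMonoidalFunctor A C.
Proof.
  refine (@MkStrongMonoidalFunctor A C (functor_comp G F)
            (fun a b => iso_comp (iso_map G (smf_tens F a b)) (smf_tens G (F a) (F b)))
            (iso_comp (iso_map G (smf_unit F)) (smf_unit G)) _ _ _ _) => /=.
  - move=> a a' b b' f g.
    by rewrite -cmp_assoc smf_tens_nat !cmp_assoc -!fmap_cmp smf_tens_nat.
  - move=> a b c.
    have e := smf_tens_nat G (fwd (smf_tens F a b)) (idm (F c)).
    have e' := smf_tens_nat G (idm (F a)) (fwd (smf_tens F b c)).
    rewrite fmap_id in e; rewrite fmap_id in e'.
    rewrite tens_idr_cmp tens_idl_cmp -!cmp_assoc (cmp_l e) (cmp_l e').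
    rewrite -!cmp_assoc (cmp_assoc (fwd (smf_tens G _ _)) _ (fwd (assoc _ _ _))) -smf_assoc.
    by rewrite !cmp_assoc -!fmap_cmp smf_assoc.
  - move=> a.
    have e := smf_tens_nat G (fwd (smf_unit F)) (idm (F a)); rewrite fmap_id in e.
    rewrite tens_idr_cmp -!cmp_assoc (cmp_l e) -!cmp_assoc -smf_lunit.
    by rewrite !cmp_assoc -!fmap_cmp smf_lunit.
  - move=> a.
    have e := smf_tens_nat G (idm (F a)) (fwd (smf_unit F)); rewrite fmap_id in e.
    rewrite tens_idl_cmp -!cmp_assoc (cmp_l e) -!cmp_assoc -smf_runit.
    by rewrite !cmp_assoc -!fmap_cmp smf_runit.
Defined.

Record MonoidalIso {A B : MonoidalCategory} (F G : StrongMonoidalFunctor A B) : Type :=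
MkMonoidalIso {
  mi_iso :> NatIso F G;
  mi_tens : forall a b : A,
    fwd (ni_iso mi_iso (a ⊗ b)) ∘ fwd (smf_tens F a b)
    = fwd (smf_tens G a b) ∘ (fwd (ni_iso mi_iso a) ⊠ fwd (ni_iso mi_iso b));
  mi_unit : fwd (ni_iso mi_iso unt) ∘ fwd (smf_unit F) = fwd (smf_unit G) }.

(** A pseudofunctor from the opposite of [S] to monoidal categories, strong monoidal
    functors and monoidal transformations.  The three coherence laws are equations between
    arrows into reindexings along the two sides of [cmp_assoc], [cmp_idr] and [cmp_idl],
    whence [HomEq]. *)
Record IndexedMonoidalCategory (S : Category) : Type := MkIndexedMonoidalCategory {
  fib :> S -> MonoidalCategory;
  pull : forall X Y : S, hom X Y -> StrongMonoidalFunctor (fib Y) (fib X);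
  pull_id : forall X : S, MonoidalIso (smf_id (fib X)) (pull (idm X));
  pull_cmp : forall (X Y Z : S) (f : hom X Y) (g : hom Y Z),
    MonoidalIso (smf_comp (pull f) (pull g)) (pull (g ∘ f));
  pull_assoc : forall (W X Y Z : S) (f : hom W X) (g : hom X Y) (h : hom Y Z) (P : fib Z),
    HomEq (fwd (ni_iso (pull_cmp f (h ∘ g)) P)
             ∘ fmap (pull f) (fwd (ni_iso (pull_cmp g h) P)))
          (fwd (ni_iso (pull_cmp (g ∘ f) h) P) ∘ fwd (ni_iso (pull_cmp f g) (pull h P)));
  pull_idl : forall (X Y : S) (f : hom X Y) (P : fib Y),
    HomEq (fwd (ni_iso (pull_cmp (idm X) f) P) ∘ fwd (ni_iso (pull_id X) (pull f P)))
          (idm (pull f P));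
  pull_idr : forall (X Y : S) (f : hom X Y) (P : fib Y),
    HomEq (fwd (ni_iso (pull_cmp f (idm Y)) P) ∘ fmap (pull f) (fwd (ni_iso (pull_id Y) P)))
          (idm (pull f P)) }.
Arguments pull {S i X Y} f : rename.
Arguments pull_id {S i} X : rename.
Arguments pull_cmp {S i X Y Z} f g : rename.

Section Over.
Context {S : FinProdCategory} {V : IndexedMonoidalCategory S}.

Definition Over {X Y : S} (f : hom X Y) (M : V X) (N : V Y) : Type := hom M (pull f N).

Definition over_cast {X Y : S} {f f' : hom X Y} (e : f = f') {M : V X} {N : V Y}
  (φ : Over f M N) : Over f' M N := match e with eq_refl => φ end.

Definition ocomp {X Y Z : S} {f : hom X Y} {g : hom Y Z} {M : V X} {N : V Y} {P : V Z}
  (ψ : Over g N P) (φ : Over f M N) : Over (g ∘ f) M P :=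
  fwd (ni_iso (pull_cmp f g) P) ∘ fmap (pull f) ψ ∘ φ.

(** Factorisation through the canonical morphism [pull g P -> P] over [g]. *)
Definition olift {X Y Z : S} {f : hom X Y} {g : hom Y Z} {M : V X} {P : V Z}
  (φ : Over (g ∘ f) M P) : Over f M (pull g P) :=
  bwd (ni_iso (pull_cmp f g) P) ∘ φ.

Definition otens {X Y : S} {f : hom X Y} {M M' : V X} {N N' : V Y}
  (φ : Over f M N) (φ' : Over f M' N') : Over f (M ⊗ M') (N ⊗ N') :=
  fwd (smf_tens (pull f) N N') ∘ (φ ⊠ φ').

Definition ounit {X Y : S} (f : hom X Y) : Over f (unt : V X) (unt : V Y) :=
  fwd (smf_unit (pull f)).

(** Equality of morphisms over possibly different base morphisms. *)
Definition OverEq {X Y : S} {f f' : hom X Y} {M : V X} {N : V Y}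
  (φ : Over f M N) (φ' : Over f' M N) : Prop :=
  existT (fun h => Over h M N) f φ = existT (fun h => Over h M N) f' φ'.

Lemma OverEq_eq {X Y : S} {f : hom X Y} {M : V X} {N : V Y} (φ φ' : Over f M N) :
  OverEq φ φ' -> φ = φ'.
Proof. exact: inj_pair2. Qed.

Lemma OverEq_refl {X Y : S} {f : hom X Y} {M : V X} {N : V Y} (φ : Over f M N) : OverEq φ φ.
Proof. reflexivity. Qed.
Lemma OverEq_sym {X Y : S} {f f' : hom X Y} {M : V X} {N : V Y}
  (φ : Over f M N) (φ' : Over f' M N) : OverEq φ φ' -> OverEq φ' φ.
Proof. exact: eq_sym. Qed.
Lemma OverEq_trans {X Y : S} {f f' f'' : hom X Y} {M : V X} {N : V Y}
  (φ : Over f M N) (φ' : Over f' M N) (φ'' : Over f'' M N) :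
  OverEq φ φ' -> OverEq φ' φ'' -> OverEq φ φ''.
Proof. exact: eq_trans. Qed.

Lemma over_cast_eq {X Y : S} {f f' : hom X Y} (e : f = f') {M : V X} {N : V Y}
  (φ : Over f M N) : OverEq (over_cast e φ) φ.
Proof. by case: f' / e. Qed.

Lemma over_cast_irr {X Y : S} {f : hom X Y} (e : f = f) {M : V X} {N : V Y}
  (φ : Over f M N) : over_cast e φ = φ.
Proof. apply: OverEq_eq; exact: over_cast_eq. Qed.

Lemma HomEq_OverEq {X Y : S} {f f' : hom X Y} {M : V X} {N : V Y}
  (φ : Over f M N) (φ' : Over f' M N) : f = f' -> HomEq φ φ' -> OverEq φ φ'.
Proof.
  move=> e; subst f' => h.
  suff H : forall (a b c d : fib V X) (p : hom a b) (q : hom c d), HomEq p q ->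
      existT (fun ab : fib V X * fib V X => hom (fst ab) (snd ab)) (a, b) p
      = existT (fun ab : fib V X * fib V X => hom (fst ab) (snd ab)) (c, d) q.
  - by rewrite (inj_pair2 _ _ _ _ _ (H _ _ _ _ _ _ h)); exact: OverEq_refl.
  - by move=> a b c d p q; case.
Qed.

Lemma OverEq_HomEq {X Y : S} {f f' : hom X Y} {M : V X} {N : V Y}
  (φ : Over f M N) (φ' : Over f' M N) : OverEq φ φ' -> HomEq φ φ'.
Proof.
  move=> h.
  exact: (eq_ind (existT (fun h => Over h M N) f φ)
            (fun s => HomEq φ (projT2 s)) (HomEq_refl φ) _ h).
Qed.

Lemma ocomp_congr {X Y Z : S} {f f' : hom X Y} {g g' : hom Y Z} {M : V X} {N : V Y} {P : V Z}
  {ψ : Over g N P} {φ : Over f M N} {ψ' : Over g' N P} {φ' : Over f' M N} :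
  OverEq ψ ψ' -> OverEq φ φ' -> OverEq (ocomp ψ φ) (ocomp ψ' φ').
Proof.
  move=> h k.
  have eg : g = g' := f_equal (@projT1 _ _) h.
  have ef : f = f' := f_equal (@projT1 _ _) k.
  subst g' f'; by rewrite (OverEq_eq h) (OverEq_eq k).
Qed.

Lemma otens_congr {X Y : S} {f f' : hom X Y} {M M' : V X} {N N' : V Y}
  {φ : Over f M N} {ψ : Over f M' N'} {φ' : Over f' M N} {ψ' : Over f' M' N'} :
  OverEq φ φ' -> OverEq ψ ψ' -> OverEq (otens φ ψ) (otens φ' ψ').
Proof.
  move=> h k.
  have ef : f = f' := f_equal (@projT1 _ _) h.
  subst f'; by rewrite (OverEq_eq h) (OverEq_eq k).
Qed.

Lemma over_pre_congr {X Y : S} {f f' : hom X Y} {M M' : V X} {N : V Y}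
  {φ : Over f M N} {φ' : Over f' M N} (k : hom M' M) :
  OverEq φ φ' -> OverEq (φ ∘ k : Over f M' N) (φ' ∘ k : Over f' M' N).
Proof.
  move=> h.
  have ef : f = f' := f_equal (@projT1 _ _) h.
  subst f'; by rewrite (OverEq_eq h).
Qed.

Lemma over_cast_pre {X Y : S} {f f' : hom X Y} (e : f = f') {M M' : V X} {N : V Y}
  (φ : Over f M N) (k : hom M' M) : over_cast e (φ ∘ k : Over f M' N) = over_cast e φ ∘ k.
Proof. by case: f' / e. Qed.

Lemma ocomp_pre {X Y Z : S} {f : hom X Y} {g : hom Y Z} {M M' : V X} {N : V Y} {P : V Z}
  (ψ : Over g N P) (φ : Over f M N) (k : hom M' M) :
  ocomp ψ (φ ∘ k : Over f M' N) = ocomp ψ φ ∘ k.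
Proof. by rewrite /ocomp !cmp_assoc. Qed.

Lemma olift_pre {X Y Z : S} {f : hom X Y} {g : hom Y Z} {M M' : V X} {P : V Z}
  (φ : Over (g ∘ f) M P) (k : hom M' M) :
  olift (φ ∘ k : Over (g ∘ f) M' P) = olift φ ∘ k.
Proof. by rewrite /olift !cmp_assoc. Qed.

Lemma otens_pre {X Y : S} {f : hom X Y} {M M' L L' : V X} {N N' : V Y}
  (φ : Over f M N) (φ' : Over f M' N') (k : hom L M) (k' : hom L' M') :
  otens (φ ∘ k : Over f L N) (φ' ∘ k' : Over f L' N') = otens φ φ' ∘ (k ⊠ k').
Proof. by rewrite /otens -cmp_assoc -tens_cmp. Qed.

Lemma ocomp_mid {X Y Z : S} {f : hom X Y} {g : hom Y Z} {M : V X} {N N' : V Y} {P : V Z}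
  (ψ : Over g N' P) (k : hom N N') (φ : Over f M N) :
  ocomp (ψ ∘ k : Over g N P) φ = ocomp ψ (fmap (pull f) k ∘ φ : Over f M N').
Proof. by rewrite /ocomp fmap_cmp !cmp_assoc. Qed.

Lemma ocomp_olift {X Y Z : S} {f : hom X Y} {g : hom Y Z} {M : V X} {P : V Z}
  (φ : Over (g ∘ f) M P) : ocomp (idm (pull g P) : Over g (pull g P) P) (olift φ) = φ.
Proof. by rewrite /ocomp /olift fmap_id cmp_idr cmp_assoc fwd_bwd cmp_idl. Qed.

Lemma olift_ocomp {X Y Z : S} {f : hom X Y} {g : hom Y Z} {M : V X} {P : V Z}
  (φ : Over f M (pull g P)) : olift (ocomp (idm (pull g P) : Over g (pull g P) P) φ) = φ.
Proof.
  by rewrite /ocomp /olift fmap_id cmp_idr cmp_assoc bwd_fwd cmp_idl.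
Qed.

Lemma ocart_inj {X Y Z : S} {f : hom X Y} {g : hom Y Z} {M : V X} {P : V Z}
  (φ φ' : Over f M (pull g P)) :
  ocomp (idm (pull g P) : Over g (pull g P) P) φ = ocomp (idm (pull g P)) φ' -> φ = φ'.
Proof. by move=> e; rewrite -(olift_ocomp φ) e olift_ocomp. Qed.

Lemma ocomp_assoc {W X Y Z : S} {f : hom W X} {g : hom X Y} {h : hom Y Z}
  {L : V W} {M : V X} {N : V Y} {P : V Z}
  (χ : Over h N P) (ψ : Over g M N) (φ : Over f L M) :
  OverEq (ocomp χ (ocomp ψ φ)) (ocomp (ocomp χ ψ) φ).
Proof.
  have H := HomEq_OverEq (M := pull f (pull g (pull h P))) (N := P)
    (eq_sym (cmp_assoc h g f)) (pull_assoc f g h P).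
  have H' := over_pre_congr (fmap (pull f) (fmap (pull g) χ) ∘ fmap (pull f) ψ ∘ φ) (OverEq_sym H).
  have e : (fwd (ni_iso (pull_cmp (g ∘ f) h) P) ∘ fwd (ni_iso (pull_cmp f g) (pull h P))
     ∘ (fmap (pull f) (fmap (pull g) χ) ∘ fmap (pull f) ψ ∘ φ)) = ocomp χ (ocomp ψ φ).
  { rewrite /ocomp -!cmp_assoc.
    by rewrite (cmp_l (ni_nat (pull_cmp f g) χ)) -!cmp_assoc. }
  rewrite -e; apply: (OverEq_trans H'); rewrite /ocomp !fmap_cmp !cmp_assoc.
  exact: OverEq_refl.
Qed.

Definition oid {X : S} (M : V X) : Over (idm X) M M := fwd (ni_iso (pull_id X) M).

Lemma ocomp_oidr {X Y : S} {f : hom X Y} {M : V X} {N : V Y} (φ : Over f M N) :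
  OverEq (ocomp φ (oid M)) φ.
Proof.
  have H := HomEq_OverEq (M := pull f N) (N := N) (cmp_idr f) (pull_idl f N).
  have H' := over_pre_congr φ H.
  apply: OverEq_trans (OverEq_trans H' _).
  - rewrite /ocomp /oid -!cmp_assoc -(ni_nat (pull_id X) φ); exact: OverEq_refl.
  - rewrite (cmp_idl φ); exact: OverEq_refl.
Qed.

Lemma ocomp_oidl {X Y : S} {f : hom X Y} {M : V X} {N : V Y} (φ : Over f M N) :
  OverEq (ocomp (oid N) φ) φ.
Proof.
  have H := HomEq_OverEq (M := pull f N) (N := N) (cmp_idl f) (pull_idr f N).
  have H' := over_pre_congr φ H.
  apply: (OverEq_trans H'); rewrite (cmp_idl φ); exact: OverEq_refl.
Qed.

Lemma otens_ocomp {X Y Z : S} {f : hom X Y} {g : hom Y Z} {M M' : V X} {N N' : V Y} {P P' : V Z}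
  (ψ : Over g N P) (ψ' : Over g N' P') (φ : Over f M N) (φ' : Over f M' N') :
  ocomp (otens ψ ψ') (otens φ φ') = otens (ocomp ψ φ) (ocomp ψ' φ').
Proof.
  have e := mi_tens (pull_cmp f g) P P'; rewrite /= in e.
  rewrite /otens /ocomp !tens_cmp !fmap_cmp -!cmp_assoc (cmp_l (eq_sym e)) -!cmp_assoc.
  by rewrite (cmp_l (smf_tens_nat (pull f) ψ ψ')) -!cmp_assoc.
Qed.

Lemma otens_oid {X : S} (M N : V X) : otens (oid M) (oid N) = oid (M ⊗ N).
Proof.
  have e := mi_tens (pull_id X) M N; rewrite /= cmp_idr in e; exact: eq_sym e.
Qed.

Lemma ounit_cmp {X Y Z : S} (f : hom X Y) (g : hom Y Z) :
  ounit (g ∘ f) = ocomp (ounit g) (ounit f).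
Proof.
  have e := mi_unit (pull_cmp (i:=V) f g); rewrite /= cmp_assoc in e; exact: eq_sym e.
Qed.

Lemma ounit_id (X : S) : ounit (idm X) = oid unt.
Proof.
  have e := mi_unit (pull_id (i:=V) X); rewrite /= cmp_idr in e; exact: eq_sym e.
Qed.

Lemma otens_assoc {X Y : S} {f : hom X Y} {L M N : V X} {L' M' N' : V Y}
  (φ : Over f L L') (ψ : Over f M M') (χ : Over f N N') :
  fmap (pull f) (fwd (assoc L' M' N')) ∘ otens (otens φ ψ) χ
  = otens φ (otens ψ χ) ∘ fwd (assoc L M N).
Proof.
  rewrite /otens -(cmp_idl χ) -(cmp_idl φ) !tens_cmp !cmp_idl.
  by rewrite !cmp_assoc smf_assoc -!cmp_assoc assoc_nat.
Qed.

Lemma otens_lunit {X Y : S} {f : hom X Y} {M : V X} {N : V Y} (φ : Over f M N) :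
  fmap (pull f) (fwd (lunit N)) ∘ otens (ounit f) φ = φ ∘ fwd (lunit M).
Proof.
  rewrite /otens /ounit -lunit_nat -smf_lunit -!cmp_assoc -tens_cmp.
  by rewrite cmp_idl cmp_idr.
Qed.

Lemma otens_runit {X Y : S} {f : hom X Y} {M : V X} {N : V Y} (φ : Over f M N) :
  fmap (pull f) (fwd (runit N)) ∘ otens φ (ounit f) = φ ∘ fwd (runit M).
Proof.
  rewrite /otens /ounit -runit_nat -smf_runit -!cmp_assoc -tens_cmp.
  by rewrite cmp_idl cmp_idr.
Qed.

Lemma otens_lunit_bwd {X Y : S} {f : hom X Y} {M : V X} {N : V Y} (φ : Over f M N) :
  fmap (pull f) (bwd (lunit N)) ∘ φ = otens (ounit f) φ ∘ bwd (lunit M).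
Proof.
  apply: (iso_epi (lunit M)); rewrite -!cmp_assoc bwd_fwd cmp_idr -otens_lunit.
  by rewrite cmp_assoc -fmap_cmp bwd_fwd fmap_id cmp_idl.
Qed.

Lemma otens_runit_bwd {X Y : S} {f : hom X Y} {M : V X} {N : V Y} (φ : Over f M N) :
  fmap (pull f) (bwd (runit N)) ∘ φ = otens φ (ounit f) ∘ bwd (runit M).
Proof.
  apply: (iso_epi (runit M)); rewrite -!cmp_assoc bwd_fwd cmp_idr -otens_runit.
  by rewrite cmp_assoc -fmap_cmp bwd_fwd fmap_id cmp_idl.
Qed.

End Over.

(** [M ⊗_Y N] *)
Definition etens {S : FinProdCategory} {V : IndexedMonoidalCategory S} {X Y Z : S}
  (M : V (X × Y)) (N : V (Y × Z)) : V (X × Y × Z) := pull pr12 M ⊗ pull pr23 N.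

Record VCatData {S : FinProdCategory} (V : IndexedMonoidalCategory S) : Type := MkVCatData {
  vob :> Type;
  ext : vob -> S;
  vhom : forall x y : vob, V (ext y × ext x);
  vid : forall x : vob, Over (diag (ext x)) unt (vhom x x);
  vcomp : forall x y z : vob, Over pr13 (etens (vhom y z) (vhom x y)) (vhom x z) }.
Arguments ext {S V v} x : rename.
Arguments vhom {S V v} x y : rename.
Arguments vid {S V v} x : rename.
Arguments vcomp {S V v} x y z : rename.

Section Elements.
Context {S : FinProdCategory} {V : IndexedMonoidalCategory S}.

(** Generalized elements of shape [M] of the hom-object [vhom x y], at the stage [(b, a)]:
    morphisms [M -> vhom x y] over [(b, a)]. *)
Definition Elt {A : VCatData V} (x y : A) {T : S} (b : hom T (ext y)) (a : hom T (ext x))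
  (M : V T) : Type := Over (pair b a) M (vhom x y).

Definition gen {A : VCatData V} (x y : A) {T : S} (b : hom T (ext y)) (a : hom T (ext x)) :
  Elt b a (pull (pair b a) (vhom x y)) := idm (pull (pair b a) (vhom x y)).

(** Composition of generalized elements: [vcomp] preceded by the morphism
    [M ⊗ N -> etens (vhom y z) (vhom x y)] over [triple c b a] induced by [m] and [n]. *)
Definition ecomp {A : VCatData V} {x y z : A} {T : S}
  {c : hom T (ext z)} {b : hom T (ext y)} {a : hom T (ext x)} {M N : V T}
  (m : Elt c b M) (n : Elt b a N) : Elt c a (M ⊗ N) :=
  over_cast (pr13_triple c b a)
    (ocomp (vcomp x y z)
       (otens (olift (over_cast (eq_sym (pr12_triple c b a)) m))
              (olift (over_cast (eq_sym (pr23_triple c b a)) n)))).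

Definition lcomp {A : VCatData V} {x y z : A} {T : S}
  {c : hom T (ext z)} {b : hom T (ext y)} {a : hom T (ext x)} {M : V T}
  (m : Elt c b unt) (n : Elt b a M) : Elt c a M := ecomp m n ∘ bwd (lunit M).

Definition rcomp {A : VCatData V} {x y z : A} {T : S}
  {c : hom T (ext z)} {b : hom T (ext y)} {a : hom T (ext x)} {M : V T}
  (m : Elt c b M) (n : Elt b a unt) : Elt c a M := ecomp m n ∘ bwd (runit M).

(** The pullback of the identity of [x] along [a]. *)
Definition eid {A : VCatData V} (x : A) {T : S} (a : hom T (ext x)) : Elt a a unt :=
  over_cast (diag_cmp a) (ocomp (vid x) (ounit a)).

Definition eres {A : VCatData V} {x y : A} {T T' : S} {b : hom T (ext y)} {a : hom T (ext x)}
  {M : V T} {M' : V T'} {u : hom T' T} (m : Elt b a M) (μ : Over u M' M) :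
  Elt (b ∘ u) (a ∘ u) M' := over_cast (pair_cmp b a u) (ocomp m μ).

(** The image of a generalized element under a morphism of hom-objects. *)
Definition eapp {A B : VCatData V} {x y : A} {x' y' : B}
  {v : hom (ext y) (ext y')} {u : hom (ext x) (ext x')}
  (φ : Over (prdm v u) (vhom x y) (vhom x' y'))
  {T : S} {b : hom T (ext y)} {a : hom T (ext x)} {M : V T} (m : Elt b a M) :
  Elt (v ∘ b) (u ∘ a) M := over_cast (prdm_pair v u b a) (ocomp φ m).
End Elements.

(** The axioms are the usual commutative diagrams.  Each is an equation between morphisms out
    of a tensor product of reindexed hom-objects, over the product of the extents involved,
    and is written by composing the universal elements. *)
Record VCategory {S : FinProdCategory} (V : IndexedMonoidalCategory S) : Type := MkVCategory {
  vdata :> VCatData V;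
  vcomp_assoc : forall x y z w : vdata,
    let T := ext w × ext z × ext y × ext x in
    let d : hom T (ext w) := pr1 in
    let c : hom T (ext z) := pr1 ∘ pr2 in
    let b : hom T (ext y) := pr1 ∘ (pr2 ∘ pr2) in
    let a : hom T (ext x) := pr2 ∘ (pr2 ∘ pr2) in
    ecomp (ecomp (gen d c) (gen c b)) (gen b a)
    = ecomp (gen d c) (ecomp (gen c b) (gen b a)) ∘ fwd (assoc _ _ _);
  vcomp_idl : forall x y : vdata,
    let b : hom (ext y × ext x) (ext y) := pr1 in
    let a : hom (ext y × ext x) (ext x) := pr2 in
    ecomp (eid b) (gen b a) = gen b a ∘ fwd (lunit _);
  vcomp_idr : forall x y : vdata,
    let b : hom (ext y × ext x) (ext y) := pr1 in
    let a : hom (ext y × ext x) (ext x) := pr2 in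
    ecomp (gen b a) (eid a) = gen b a ∘ fwd (runit _) }.

Section ElementLemmas.
Context {S : FinProdCategory} {V : IndexedMonoidalCategory S}.

Lemma ecomp_spec {A : VCatData V} {x y z : A} {T : S}
  {c : hom T (ext z)} {b : hom T (ext y)} {a : hom T (ext x)} {M N : V T}
  (m : Elt c b M) (n : Elt b a N) {t : hom T (ext z × ext y × ext x)}
  (m' : Over t M (pull pr12 (vhom y z))) (n' : Over t N (pull pr23 (vhom x y))) :
  OverEq (ocomp (idm _ : Over pr12 _ _) m') m ->
  OverEq (ocomp (idm _ : Over pr23 _ _) n') n ->
  OverEq (ecomp m n) (ocomp (vcomp x y z) (otens m' n')).
Proof.
  move=> hm hn.
  have e1 : pr12 ∘ t = pair c b := f_equal (@projT1 _ _) hm.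
  have e2 : pr23 ∘ t = pair b a := f_equal (@projT1 _ _) hn.
  have et : t = triple c b a.
  { rewrite (pair_unique t) (pair_unique (pr2 ∘ t)) /triple.
    move: e1 e2; rewrite /pr12 /pr23 !pair_cmp => /pair_inj [-> e1] /pair_inj [e2 e3].
    by rewrite -e2 -e3 !cmp_assoc. }
  subst t; apply: (OverEq_trans (over_cast_eq _ _)).
  apply: ocomp_congr; first exact: OverEq_refl.
  apply: otens_congr.
  - suff -> : m' = olift (over_cast (eq_sym (pr12_triple c b a)) m) by exact: OverEq_refl.
    apply: ocart_inj; rewrite ocomp_olift; apply: OverEq_eq.
    exact: OverEq_trans hm (OverEq_sym (over_cast_eq _ _)).
  - suff -> : n' = olift (over_cast (eq_sym (pr23_triple c b a)) n) by exact: OverEq_refl.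
    apply: ocart_inj; rewrite ocomp_olift; apply: OverEq_eq.
    exact: OverEq_trans hn (OverEq_sym (over_cast_eq _ _)).
Qed.

Lemma ecomp_factors {A : VCatData V} {x y z : A} {T : S}
  {c : hom T (ext z)} {b : hom T (ext y)} {a : hom T (ext x)} {M N : V T}
  (m : Elt c b M) (n : Elt b a N) :
  exists (m' : Over (triple c b a) M (pull pr12 (vhom y z)))
         (n' : Over (triple c b a) N (pull pr23 (vhom x y))),
  OverEq (ocomp (idm _ : Over pr12 _ _) m') m /\ OverEq (ocomp (idm _ : Over pr23 _ _) n') n.
Proof.
  exists (olift (over_cast (eq_sym (pr12_triple c b a)) m)),
         (olift (over_cast (eq_sym (pr23_triple c b a)) n)).
  by rewrite !ocomp_olift; split; apply: over_cast_eq.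
Qed.

Lemma ecomp_congr {A : VCatData V} {x y z : A} {T : S}
  {c c' : hom T (ext z)} {b b' : hom T (ext y)} {a a' : hom T (ext x)} {M N : V T}
  {m : Elt c b M} {n : Elt b a N} {m' : Elt c' b' M} {n' : Elt b' a' N} :
  OverEq m m' -> OverEq n n' -> OverEq (ecomp m n) (ecomp m' n').
Proof.
  move=> hm hn.
  have [ec eb] := pair_inj (f_equal (@projT1 _ _) hm : pair c b = pair c' b').
  have [_ ea] := pair_inj (f_equal (@projT1 _ _) hn : pair b a = pair b' a').
  subst c' b' a'; by rewrite (OverEq_eq hm) (OverEq_eq hn).
Qed.

Lemma ecomp_factor {A : VCatData V} {x y z : A} {T T' : S} {u : hom T' T}
  {c : hom T (ext z)} {b : hom T (ext y)} {a : hom T (ext x)} {M N : V T}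
  {c' : hom T' (ext z)} {b' : hom T' (ext y)} {a' : hom T' (ext x)} {M' N' : V T'}
  {m : Elt c b M} {n : Elt b a N} {m' : Elt c' b' M'} {n' : Elt b' a' N'}
  {μ : Over u M' M} {ν : Over u N' N} :
  OverEq m' (ocomp m μ) -> OverEq n' (ocomp n ν) ->
  OverEq (ecomp m' n') (ocomp (ecomp m n) (otens μ ν)).
Proof.
  move=> hm hn; have [m1 [n1 [em en]]] := ecomp_factors m n.
  apply: (OverEq_trans (ecomp_spec (m' := ocomp m1 μ) (n' := ocomp n1 ν) _ _)).
  - apply: (OverEq_trans (ocomp_assoc _ _ _)).
    exact: (OverEq_trans (ocomp_congr em (OverEq_refl _)) (OverEq_sym hm)).
  - apply: (OverEq_trans (ocomp_assoc _ _ _)).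
    exact: (OverEq_trans (ocomp_congr en (OverEq_refl _)) (OverEq_sym hn)).
  - rewrite -otens_ocomp; apply: (OverEq_trans (ocomp_assoc _ _ _)).
    apply: (ocomp_congr _ (OverEq_refl _)); apply: OverEq_sym; exact: ecomp_spec.
Qed.

Lemma ecomp_pre {A : VCatData V} {x y z : A} {T : S}
  {c : hom T (ext z)} {b : hom T (ext y)} {a : hom T (ext x)} {M N M' N' : V T}
  (m : Elt c b M) (n : Elt b a N) (k : hom M' M) (l : hom N' N) :
  ecomp (m ∘ k : Elt c b M') (n ∘ l : Elt b a N') = ecomp m n ∘ (k ⊠ l).
Proof.
  by rewrite /ecomp (over_cast_pre (eq_sym _) m k) (over_cast_pre (eq_sym _) n l) !olift_pre otens_pre
    ocomp_pre over_cast_pre.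
Qed.

Lemma ecomp_prel {A : VCatData V} {x y z : A} {T : S}
  {c : hom T (ext z)} {b : hom T (ext y)} {a : hom T (ext x)} {M N M' : V T}
  (m : Elt c b M) (n : Elt b a N) (k : hom M' M) :
  ecomp (m ∘ k : Elt c b M') n = ecomp m n ∘ (k ⊠ idm N).
Proof. by rewrite -ecomp_pre cmp_idr. Qed.

Lemma ecomp_prer {A : VCatData V} {x y z : A} {T : S}
  {c : hom T (ext z)} {b : hom T (ext y)} {a : hom T (ext x)} {M N N' : V T}
  (m : Elt c b M) (n : Elt b a N) (l : hom N' N) :
  ecomp m (n ∘ l : Elt b a N') = ecomp m n ∘ (idm M ⊠ l).
Proof. by rewrite -ecomp_pre cmp_idr. Qed.

Lemma gen_factor {A : VCatData V} {x y : A} {T T' : S} {u : hom T' T}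
  {b : hom T (ext y)} {a : hom T (ext x)} {b' : hom T' (ext y)} {a' : hom T' (ext x)}
  {M : V T'} (m : Elt b' a' M) :
  b ∘ u = b' -> a ∘ u = a' ->
  exists μ : Over u M (pull (pair b a) (vhom x y)), OverEq m (ocomp (gen b a) μ).
Proof.
  move=> eb ea; subst b' a'.
  exists (olift (over_cast (eq_sym (pair_cmp b a u)) m)).
  rewrite ocomp_olift; exact: OverEq_sym (over_cast_eq _ _).
Qed.

Lemma eres_eq {A : VCatData V} {x y : A} {T T' : S} {b : hom T (ext y)} {a : hom T (ext x)}
  {M : V T} {M' : V T'} {u : hom T' T} (m : Elt b a M) (μ : Over u M' M) :
  OverEq (eres m μ) (ocomp m μ).
Proof. exact: over_cast_eq. Qed.

Lemma eres_ecomp {A : VCatData V} {x y z : A} {T T' : S} {u : hom T' T}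
  {c : hom T (ext z)} {b : hom T (ext y)} {a : hom T (ext x)} {M N : V T} {M' N' : V T'}
  (m : Elt c b M) (n : Elt b a N) (μ : Over u M' M) (ν : Over u N' N) :
  eres (ecomp m n) (otens μ ν) = ecomp (eres m μ) (eres n ν).
Proof.
  apply: OverEq_eq; apply: (OverEq_trans (eres_eq _ _)); apply: OverEq_sym.
  by apply: ecomp_factor; apply: eres_eq.
Qed.

Lemma eres_mid {A : VCatData V} {x y : A} {T T' : S} {b : hom T (ext y)} {a : hom T (ext x)}
  {M N : V T} {M' : V T'} {u : hom T' T} (m : Elt b a N) (k : hom M N) (μ : Over u M' M) :
  eres (m ∘ k : Elt b a M) μ = eres m (fmap (pull u) k ∘ μ : Over u M' N).
Proof. by rewrite /eres ocomp_mid. Qed.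

Lemma eres_pre {A : VCatData V} {x y : A} {T T' : S} {b : hom T (ext y)} {a : hom T (ext x)}
  {M : V T} {M' M'' : V T'} {u : hom T' T} (m : Elt b a M) (μ : Over u M' M) (k : hom M'' M') :
  eres m (μ ∘ k : Over u M'' M) = eres m μ ∘ k.
Proof. by rewrite /eres ocomp_pre over_cast_pre. Qed.

Lemma eres_lcomp {A : VCatData V} {x y z : A} {T T' : S} {u : hom T' T}
  {c : hom T (ext z)} {b : hom T (ext y)} {a : hom T (ext x)} {M : V T} {M' : V T'}
  (m : Elt c b unt) (n : Elt b a M) (μ : Over u M' M) :
  eres (lcomp m n) μ = lcomp (eres m (ounit u)) (eres n μ).
Proof. by rewrite /lcomp eres_mid otens_lunit_bwd eres_pre eres_ecomp. Qed.

Lemma eres_rcomp {A : VCatData V} {x y z : A} {T T' : S} {u : hom T' T}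
  {c : hom T (ext z)} {b : hom T (ext y)} {a : hom T (ext x)} {M : V T} {M' : V T'}
  (m : Elt c b M) (n : Elt b a unt) (μ : Over u M' M) :
  eres (rcomp m n) μ = rcomp (eres m μ) (eres n (ounit u)).
Proof. by rewrite /rcomp eres_mid otens_runit_bwd eres_pre eres_ecomp. Qed.

Lemma lcomp_congr {A : VCatData V} {x y z : A} {T : S}
  {c c' : hom T (ext z)} {b b' : hom T (ext y)} {a a' : hom T (ext x)} {M : V T}
  {m : Elt c b unt} {n : Elt b a M} {m' : Elt c' b' unt} {n' : Elt b' a' M} :
  OverEq m m' -> OverEq n n' -> OverEq (lcomp m n) (lcomp m' n').
Proof. by move=> hm hn; apply/over_pre_congr/ecomp_congr. Qed.

Lemma rcomp_congr {A : VCatData V} {x y z : A} {T : S}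
  {c c' : hom T (ext z)} {b b' : hom T (ext y)} {a a' : hom T (ext x)} {M : V T}
  {m : Elt c b M} {n : Elt b a unt} {m' : Elt c' b' M} {n' : Elt b' a' unt} :
  OverEq m m' -> OverEq n n' -> OverEq (rcomp m n) (rcomp m' n').
Proof. by move=> hm hn; apply/over_pre_congr/ecomp_congr. Qed.

Lemma lcomp_rcomp {A : VCatData V} {x y z : A} {T : S}
  {c : hom T (ext z)} {b : hom T (ext y)} {a : hom T (ext x)}
  (m : Elt c b (unt : V T)) (n : Elt b a unt) : lcomp m n = rcomp m n.
Proof. by rewrite /lcomp /rcomp lunit_runit_bwd. Qed.

Lemma eid_eq {A : VCatData V} (x : A) {T : S} (a : hom T (ext x)) :
  OverEq (eid a) (ocomp (vid x) (ounit a)).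
Proof. exact: over_cast_eq. Qed.

Lemma eres_eid {A : VCatData V} (x : A) {T T' : S} (a : hom T (ext x)) (u : hom T' T) :
  eres (eid a) (ounit u) = eid (a ∘ u).
Proof.
  apply: OverEq_eq; apply: (OverEq_trans (eres_eq _ _)).
  apply: (OverEq_trans (ocomp_congr (eid_eq a) (OverEq_refl _))).
  apply: OverEq_sym; apply: (OverEq_trans (eid_eq _)).
  rewrite ounit_cmp; exact: ocomp_assoc.
Qed.

Lemma eapp_eq {A B : VCatData V} {x y : A} {x' y' : B}
  {v : hom (ext y) (ext y')} {u : hom (ext x) (ext x')}
  (φ : Over (prdm v u) (vhom x y) (vhom x' y'))
  {T : S} {b : hom T (ext y)} {a : hom T (ext x)} {M : V T} (m : Elt b a M) :
  OverEq (eapp φ m) (ocomp φ m).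
Proof. exact: over_cast_eq. Qed.

Lemma eapp_pre {A B : VCatData V} {x y : A} {x' y' : B}
  {v : hom (ext y) (ext y')} {u : hom (ext x) (ext x')}
  (φ : Over (prdm v u) (vhom x y) (vhom x' y'))
  {T : S} {b : hom T (ext y)} {a : hom T (ext x)} {M M' : V T} (m : Elt b a M) (k : hom M' M) :
  eapp φ (m ∘ k : Elt b a M') = eapp φ m ∘ k.
Proof. by rewrite /eapp ocomp_pre over_cast_pre. Qed.

Lemma eapp_congr {A B : VCatData V} {x y : A} {x' y' : B}
  {v : hom (ext y) (ext y')} {u : hom (ext x) (ext x')}
  (φ : Over (prdm v u) (vhom x y) (vhom x' y'))
  {T : S} {b b' : hom T (ext y)} {a a' : hom T (ext x)} {M : V T}
  {m : Elt b a M} {m' : Elt b' a' M} :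
  OverEq m m' -> OverEq (eapp φ m) (eapp φ m').
Proof.
  move=> h; apply: (OverEq_trans (eapp_eq _ _)); apply: OverEq_sym.
  apply: (OverEq_trans (eapp_eq _ _)); apply: OverEq_sym.
  exact: ocomp_congr (OverEq_refl _) h.
Qed.

Lemma eapp_eres {A B : VCatData V} {x y : A} {x' y' : B}
  {v : hom (ext y) (ext y')} {u : hom (ext x) (ext x')}
  (φ : Over (prdm v u) (vhom x y) (vhom x' y'))
  {T T' : S} {b : hom T (ext y)} {a : hom T (ext x)} {M : V T} {M' : V T'} {t : hom T' T}
  (m : Elt b a M) (μ : Over t M' M) :
  OverEq (eapp φ (eres m μ)) (eres (eapp φ m) μ).
Proof.
  apply: (OverEq_trans (eapp_eq _ _)).
  apply: (OverEq_trans (ocomp_congr (OverEq_refl _) (eres_eq _ _))).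
  apply: (OverEq_trans (ocomp_assoc _ _ _)).
  apply: OverEq_sym; apply: (OverEq_trans (eres_eq _ _)).
  exact: (ocomp_congr (eapp_eq _ _) (OverEq_refl _)).
Qed.

Section InCategory.
Context {A : VCategory V}.

Lemma ecomp_assoc {x y z w : A} {T : S}
  {d : hom T (ext w)} {c : hom T (ext z)} {b : hom T (ext y)} {a : hom T (ext x)}
  {L M N : V T} (l : Elt d c L) (m : Elt c b M) (n : Elt b a N) :
  ecomp (ecomp l m) n = ecomp l (ecomp m n) ∘ fwd (assoc L M N).
Proof.
  have E := vcomp_assoc x y z w; cbv zeta in E.
  pose u : hom T (ext w × ext z × ext y × ext x) := pair d (triple c b a).
  have ed : pr1 ∘ u = d by rewrite /u pr1_pair.
  have ec : pr1 ∘ pr2 ∘ u = c by rewrite /u -cmp_assoc pr2_pair pr1_pair.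
  have eb : pr1 ∘ (pr2 ∘ pr2) ∘ u = b by rewrite /u -!cmp_assoc !pr2_pair pr1_pair.
  have ea : pr2 ∘ (pr2 ∘ pr2) ∘ u = a by rewrite /u -!cmp_assoc !pr2_pair.
  have [l' hl] := gen_factor l ed ec.
  have [m' hm] := gen_factor m ec eb.
  have [n' hn] := gen_factor n eb ea.
  apply: OverEq_eq.
  apply: (OverEq_trans (ecomp_factor (ecomp_factor hl hm) hn)).
  rewrite E ocomp_mid otens_assoc ocomp_pre.
  apply: over_pre_congr; apply: OverEq_sym.
  exact: ecomp_factor hl (ecomp_factor hm hn).
Qed.

Lemma lcomp_eid {x y : A} {T : S} {b : hom T (ext y)} {a : hom T (ext x)} {M : V T}
  (m : Elt b a M) : lcomp (eid b) m = m.
Proof.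
  have E := vcomp_idl x y; cbv zeta in E.
  have eb : pr1 ∘ pair b a = b by rewrite pr1_pair.
  have ea : pr2 ∘ pair b a = a by rewrite pr2_pair.
  have [μ hm] := gen_factor m eb ea.
  have hb : OverEq (eid b) (ocomp (eid pr1) (ounit (pair b a))).
  { apply: (OverEq_trans _ (eres_eq _ _)); rewrite eres_eid eb; exact: OverEq_refl. }
  rewrite /lcomp; suff -> : ecomp (eid b) m = m ∘ fwd (lunit M).
  { by rewrite -cmp_assoc fwd_bwd cmp_idr. }
  apply: OverEq_eq; apply: (OverEq_trans (ecomp_factor hb hm)).
  rewrite E ocomp_mid otens_lunit ocomp_pre.
  exact/over_pre_congr/OverEq_sym.
Qed.

Lemma rcomp_eid {x y : A} {T : S} {b : hom T (ext y)} {a : hom T (ext x)} {M : V T}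
  (m : Elt b a M) : rcomp m (eid a) = m.
Proof.
  have E := vcomp_idr x y; cbv zeta in E.
  have eb : pr1 ∘ pair b a = b by rewrite pr1_pair.
  have ea : pr2 ∘ pair b a = a by rewrite pr2_pair.
  have [μ hm] := gen_factor m eb ea.
  have hb : OverEq (eid a) (ocomp (eid pr2) (ounit (pair b a))).
  { apply: (OverEq_trans _ (eres_eq _ _)); rewrite eres_eid ea; exact: OverEq_refl. }
  rewrite /rcomp; suff -> : ecomp m (eid a) = m ∘ fwd (runit M).
  { by rewrite -cmp_assoc fwd_bwd cmp_idr. }
  apply: OverEq_eq; apply: (OverEq_trans (ecomp_factor hm hb)).
  rewrite E ocomp_mid otens_runit ocomp_pre.
  exact/over_pre_congr/OverEq_sym.
Qed.

Section Assoc.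
Context {x y z w : A} {T : S} {d : hom T (ext w)} {c : hom T (ext z)}
  {b : hom T (ext y)} {a : hom T (ext x)} {M : V T}.

Lemma lcomp_assoc (l : Elt d c unt) (m : Elt c b unt) (n : Elt b a M) :
  lcomp l (lcomp m n) = lcomp (lcomp l m) n.
Proof.
  rewrite /lcomp ecomp_prel ecomp_prer ecomp_assoc -!cmp_assoc; congr (_ ∘ _).
  by rewrite lunit_runit_bwd (cmp_l (triangle_bwd _ _)).
Qed.

Lemma rcomp_assoc (l : Elt d c M) (m : Elt c b unt) (n : Elt b a unt) :
  rcomp (rcomp l m) n = rcomp l (lcomp m n).
Proof.
  rewrite /rcomp /lcomp ecomp_prel ecomp_prer ecomp_assoc -!cmp_assoc; congr (_ ∘ _).
  by rewrite (cmp_l (triangle_bwd _ _)).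
Qed.

Lemma lrcomp_assoc (l : Elt d c unt) (m : Elt c b M) (n : Elt b a unt) :
  rcomp (lcomp l m) n = lcomp l (rcomp m n).
Proof.
  rewrite /rcomp /lcomp ecomp_prel ecomp_prer ecomp_assoc -!cmp_assoc; congr (_ ∘ _).
  by rewrite (cmp_l (lunit_tens_bwd _ _)) lunit_nat_bwd.
Qed.
End Assoc.
End InCategory.
End ElementLemmas.

Section Functors.
Context {S : FinProdCategory} {V : IndexedMonoidalCategory S}.

Record VFunctor (A B : VCategory V) : Type := MkVFunctor {
  vfob :> A -> B;
  vfext : forall x : A, hom (ext x) (ext (vfob x));
  vfhom : forall x y : A,
    Over (prdm (vfext y) (vfext x)) (vhom x y) (vhom (vfob x) (vfob y));
  vf_id : forall x : A,
    eapp (vfhom x x) (vid x : Elt (idm (ext x)) (idm (ext x)) unt)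
    = eid (vfext x ∘ idm (ext x));
  vf_comp : forall x y z : A,
    eapp (vfhom x z) (vcomp x y z : Elt pr1 (pr2 ∘ pr2) _)
    = ecomp (eapp (vfhom y z) (gen pr1 (pr1 ∘ pr2)))
            (eapp (vfhom x y) (gen (pr1 ∘ pr2) (pr2 ∘ pr2))) }.

(** The last equation is the naturality square at [(x, y)], whose corner is [vhom x y]. *)
Record VNat {A B : VCategory V} (F G : VFunctor A B) : Type := MkVNat {
  vncomp : forall x : A, Elt (vfext G x) (vfext F x) unt;
  vn_nat : forall x y : A,
    let b : hom (ext y × ext x) (ext y) := pr1 in
    let a : hom (ext y × ext x) (ext x) := pr2 in
    lcomp (eres (vncomp y) (ounit b)) (eapp (vfhom F x y) (gen b a))
    = rcomp (eapp (vfhom G x y) (gen b a)) (eres (vncomp x) (ounit a)) }.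
Arguments vncomp {A B F G} v x : rename.

Lemma VNat_eq {A B : VCategory V} {F G : VFunctor A B} (α β : VNat F G) :
  (forall x, vncomp α x = vncomp β x) -> α = β.
Proof.
  case: α => a ha; case: β => b hb /= e.
  have e' : a = b by exact: functional_extensionality_dep.
  subst b; by rewrite (proof_irrelevance _ ha hb).
Qed.


Section Laws.
Context {A B : VCategory V} (F : VFunctor A B).

Lemma eapp_eid {x : A} {T : S} (a : hom T (ext x)) :
  eapp (vfhom F x x) (eid a) = eid (vfext F x ∘ a).
Proof.
  have h : OverEq (eid a) (eres (vid x : Elt (idm (ext x)) (idm (ext x)) unt) (ounit a)).
  { apply: (OverEq_trans (eid_eq a)); apply: OverEq_sym; exact: eres_eq. }
  apply: OverEq_eq; apply: (OverEq_trans (eapp_congr _ h)).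
  apply: (OverEq_trans (eapp_eres _ _ _)).
  rewrite vf_id eres_eid -cmp_assoc cmp_idl; exact: OverEq_refl.
Qed.

Lemma eapp_ecomp {x y z : A} {T : S}
  {c : hom T (ext z)} {b : hom T (ext y)} {a : hom T (ext x)} {M N : V T}
  (m : Elt c b M) (n : Elt b a N) :
  eapp (vfhom F x z) (ecomp m n) = ecomp (eapp (vfhom F y z) m) (eapp (vfhom F x y) n).
Proof.
  have [m' [n' [em en]]] := ecomp_factors m n.
  have h : OverEq (ecomp m n)
    (eres (vcomp x y z : Elt pr1 (pr2 ∘ pr2) _) (otens m' n')).
  { apply: (OverEq_trans (ecomp_spec em en)); apply: OverEq_sym; exact: eres_eq. }
  apply: OverEq_eq; apply: (OverEq_trans (eapp_congr _ h)).
  apply: (OverEq_trans (eapp_eres _ _ _)).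
  rewrite vf_comp eres_ecomp; apply: ecomp_congr.
  - apply: (OverEq_trans (OverEq_sym (eapp_eres _ _ _))); apply: eapp_congr.
    exact: (OverEq_trans (eres_eq _ _) em).
  - apply: (OverEq_trans (OverEq_sym (eapp_eres _ _ _))); apply: eapp_congr.
    exact: (OverEq_trans (eres_eq _ _) en).
Qed.

Lemma eapp_lcomp {x y z : A} {T : S}
  {c : hom T (ext z)} {b : hom T (ext y)} {a : hom T (ext x)} {M : V T}
  (m : Elt c b unt) (n : Elt b a M) :
  eapp (vfhom F x z) (lcomp m n) = lcomp (eapp (vfhom F y z) m) (eapp (vfhom F x y) n).
Proof. by rewrite /lcomp eapp_pre eapp_ecomp. Qed.

Lemma eapp_rcomp {x y z : A} {T : S}
  {c : hom T (ext z)} {b : hom T (ext y)} {a : hom T (ext x)} {M : V T}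
  (m : Elt c b M) (n : Elt b a unt) :
  eapp (vfhom F x z) (rcomp m n) = rcomp (eapp (vfhom F y z) m) (eapp (vfhom F x y) n).
Proof. by rewrite /rcomp eapp_pre eapp_ecomp. Qed.
End Laws.

Lemma vnat_elt {A B : VCategory V} {F G : VFunctor A B} (α : VNat F G)
  {x y : A} {T : S} {b : hom T (ext y)} {a : hom T (ext x)} {M : V T} (m : Elt b a M) :
  lcomp (eres (vncomp α y) (ounit b)) (eapp (vfhom F x y) m)
  = rcomp (eapp (vfhom G x y) m) (eres (vncomp α x) (ounit a)).
Proof.
  have E := vn_nat α x y; cbv zeta in E.
  have eb : pr1 ∘ pair b a = b by rewrite pr1_pair.
  have ea : pr2 ∘ pair b a = a by rewrite pr2_pair.
  have [μ hm'] := gen_factor m eb ea.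
  have hm := OverEq_trans hm' (OverEq_sym (eres_eq _ _)).
  have h := f_equal (fun q => eres q μ) E; rewrite eres_lcomp eres_rcomp in h.
  have res : forall (z w : B) (T1 T2 : S) (c : hom T1 (ext w)) (d : hom T1 (ext z))
     (T3 : S) (n : Elt c d unt) (u : hom T2 T1) (v : hom T3 T2) (w : hom T3 T1), u ∘ v = w ->
     OverEq (eres (eres n (ounit u)) (ounit v)) (eres n (ounit w)).
  { move=> z w T1 T2 c d T3 n u v k <-; apply: (OverEq_trans (eres_eq _ _)).
    apply: (OverEq_trans (ocomp_congr (eres_eq _ _) (OverEq_refl _))).
    apply: OverEq_sym; apply: (OverEq_trans (eres_eq _ _)).
    rewrite ounit_cmp; exact: ocomp_assoc. }
  apply: OverEq_eq.
  apply: (@OverEq_trans _ _ _ _ _ _ _ _ _ _ _ _ (OverEq_trans _ _)); last first.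
  - apply: rcomp_congr; last by apply: res; exact: ea.
    apply: (OverEq_trans (OverEq_sym (eapp_eres _ _ _))).
    apply: eapp_congr; exact: OverEq_sym hm.
  - rewrite -h; exact: OverEq_refl.
  - apply: lcomp_congr; first by apply: OverEq_sym; apply: res; exact: eb.
    apply: (OverEq_trans (eapp_congr _ hm)); exact: eapp_eres.
Qed.

Definition vnat_id {A B : VCategory V} (F : VFunctor A B) : VNat F F.
Proof.
  refine (@MkVNat A B F F (fun x => eid (vfext F x)) _).
  by move=> x y b a; rewrite !eres_eid lcomp_eid rcomp_eid.
Defined.

Definition vnat_comp {A B : VCategory V} {F G H : VFunctor A B} (β : VNat G H) (α : VNat F G) :
  VNat F H.
Proof.
  refine (@MkVNat A B F H (fun x => lcomp (vncomp β x) (vncomp α x)) _).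
  move=> x y b a; rewrite !eres_lcomp -lcomp_assoc vnat_elt -lrcomp_assoc vnat_elt.
  by rewrite rcomp_assoc.
Defined.

Definition VFunctors (A B : VCategory V) : Category.
Proof.
  refine (@MkCategory (VFunctor A B) (@VNat A B) (@vnat_id A B) (@vnat_comp A B) _ _ _).
  - by move=> F G H K γ β α; apply: VNat_eq => x /=; rewrite lcomp_assoc.
  - by move=> F G α; apply: VNat_eq => x /=; rewrite lcomp_eid.
  - by move=> F G α; apply: VNat_eq => x /=; rewrite lcomp_rcomp rcomp_eid.
Defined.

Lemma eid_congr {A : VCatData V} {x : A} {T : S} {a a' : hom T (ext x)} :
  a = a' -> OverEq (eid a) (eid a').
Proof. move=> ->; exact: OverEq_refl. Qed.

Lemma eid_idm {A : VCatData V} (x : A) : OverEq (eid (idm (ext x))) (vid x).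
Proof.
  apply: (OverEq_trans (eid_eq _)); rewrite ounit_id; exact: ocomp_oidr.
Qed.

Lemma eres_ounit_id {A : VCatData V} {x y : A} {T : S} {b : hom T (ext y)} {a : hom T (ext x)}
  (m : Elt b a unt) : OverEq (eres m (ounit (idm T))) m.
Proof.
  apply: (OverEq_trans (eres_eq _ _)); rewrite ounit_id; exact: ocomp_oidr.
Qed.

Lemma eres_ounit_cmp {A : VCatData V} {x y : A} {T T' T'' : S}
  {b : hom T (ext y)} {a : hom T (ext x)} (m : Elt b a unt) (u : hom T' T) (v : hom T'' T') :
  OverEq (eres (eres m (ounit u)) (ounit v)) (eres m (ounit (u ∘ v))).
Proof.
  apply: (OverEq_trans (eres_eq _ _)).
  apply: (OverEq_trans (ocomp_congr (eres_eq _ _) (OverEq_refl _))).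
  apply: OverEq_sym; apply: (OverEq_trans (eres_eq _ _)).
  rewrite ounit_cmp; exact: ocomp_assoc.
Qed.

Lemma vcomp_gen {A : VCatData V} (x y z : A) :
  OverEq (vcomp x y z)
    (ecomp (gen pr1 (pr1 ∘ pr2) : Elt (y := z) (x := y) _ _ _)
           (gen (pr1 ∘ pr2) (pr2 ∘ pr2) : Elt (y := y) (x := x) _ _ _)).
Proof.
  apply: OverEq_sym.
  apply: (OverEq_trans (ecomp_spec (t := idm _) (m' := oid _) (n' := oid _) _ _)).
  - exact: ocomp_oidr.
  - exact: ocomp_oidr.
  - rewrite otens_oid; exact: ocomp_oidr.
Qed.

Lemma prdm_id (X Y : S) : idm (X × Y) = prdm (idm X) (idm Y).
Proof. by rewrite /prdm !cmp_idl (pair_unique (idm _)) !cmp_idr. Qed.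

Lemma prdm_cmp {X X' X'' Y Y' Y'' : S} (f' : hom X' X'') (f : hom X X')
  (g' : hom Y' Y'') (g : hom Y Y') : prdm f' g' ∘ prdm f g = prdm (f' ∘ f) (g' ∘ g).
Proof. by rewrite {2}/prdm prdm_pair /prdm !cmp_assoc. Qed.

Lemma eapp_id {A : VCatData V} {x y : A} {T : S} {b : hom T (ext y)} {a : hom T (ext x)}
  {M : V T} (m : Elt b a M) :
  OverEq (eapp (over_cast (prdm_id (ext y) (ext x)) (oid (vhom x y))) m) m.
Proof.
  apply: (OverEq_trans (eapp_eq _ _)).
  apply: (OverEq_trans (ocomp_congr (over_cast_eq _ _) (OverEq_refl _))).
  exact: ocomp_oidl.
Qed.

Definition vfunctor_id (A : VCategory V) : VFunctor A A.
Proof.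
  refine (@MkVFunctor A A (fun x => x) (fun x => idm (ext x))
            (fun x y => over_cast (prdm_id (ext y) (ext x)) (oid (vhom x y))) _ _).
  - move=> x; apply: OverEq_eq; apply: (OverEq_trans (eapp_id _)).
    rewrite cmp_idl; exact: OverEq_sym (eid_idm x).
  - move=> x y z; apply: OverEq_eq; apply: (OverEq_trans (eapp_id _)).
    apply: (OverEq_trans (vcomp_gen x y z)).
    by apply: ecomp_congr; apply: OverEq_sym; apply: eapp_id.
Defined.

Lemma eapp_comp {A B C : VCatData V} {x y : A} {x' y' : B} {x'' y'' : C}
  {v : hom (ext y) (ext y')} {u : hom (ext x) (ext x')}
  {v' : hom (ext y') (ext y'')} {u' : hom (ext x') (ext x'')}
  (ψ : Over (prdm v' u') (vhom x' y') (vhom x'' y''))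
  (φ : Over (prdm v u) (vhom x y) (vhom x' y'))
  {T : S} {b : hom T (ext y)} {a : hom T (ext x)} {M : V T} (m : Elt b a M) :
  OverEq (eapp (over_cast (prdm_cmp v' v u' u) (ocomp ψ φ)) m) (eapp ψ (eapp φ m)).
Proof.
  apply: (OverEq_trans (eapp_eq _ _)).
  apply: (OverEq_trans (ocomp_congr (over_cast_eq _ _) (OverEq_refl _))).
  apply: OverEq_sym; apply: (OverEq_trans (eapp_eq _ _)).
  apply: (OverEq_trans (ocomp_congr (OverEq_refl _) (eapp_eq _ _))).
  exact: ocomp_assoc.
Qed.

Definition vfunctor_comp {A B C : VCategory V} (G : VFunctor B C) (F : VFunctor A B) :
  VFunctor A C.
Proof.
  refine (@MkVFunctor A C (fun x => G (F x)) (fun x => vfext G (F x) ∘ vfext F x)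
            (fun x y => over_cast (prdm_cmp _ _ _ _)
                          (ocomp (vfhom G (F x) (F y)) (vfhom F x y))) _ _).
  - move=> x; apply: OverEq_eq; apply: (OverEq_trans (eapp_comp _ _ _)).
    rewrite vf_id eapp_eid; apply: eid_congr; exact: cmp_assoc.
  - move=> x y z; apply: OverEq_eq; apply: (OverEq_trans (eapp_comp _ _ _)).
    rewrite vf_comp eapp_ecomp.
    by apply: ecomp_congr; apply: OverEq_sym; apply: eapp_comp.
Defined.

Definition vnat_hcomp {A B C : VCategory V} {G G' : VFunctor B C} {F F' : VFunctor A B}
  (β : VNat G G') (α : VNat F F') : VNat (vfunctor_comp G F) (vfunctor_comp G' F').
Proof.
  refine (@MkVNat A C (vfunctor_comp G F) (vfunctor_comp G' F')
            (fun x => lcomp (eres (vncomp β (F' x)) (ounit (vfext F' x)))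
                            (eapp (vfhom G (F x) (F' x)) (vncomp α x))) _).
  move=> x y b a; apply: OverEq_eq; rewrite !eres_lcomp.
  apply: (OverEq_trans (lcomp_congr (lcomp_congr (eres_ounit_cmp _ _ _)
            (OverEq_sym (eapp_eres _ _ _))) (eapp_comp _ _ _))).
  rewrite -lcomp_assoc -(eapp_lcomp G) (vnat_elt α) (eapp_rcomp G) -lrcomp_assoc (vnat_elt β) rcomp_assoc.
  apply: rcomp_congr; first exact: OverEq_sym (eapp_comp _ _ _).
  apply: lcomp_congr; first exact: OverEq_sym (eres_ounit_cmp _ _ _).
  exact: eapp_eres.
Defined.

Lemma VFunctor_ext {A B : VCategory V} (fo : A -> B) e h i c e' h' i' c' :
  (forall x, e x = e' x) -> (forall x y, OverEq (h x y) (h' x y)) ->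
  @MkVFunctor A B fo e h i c = @MkVFunctor A B fo e' h' i' c'.
Proof.
  move=> he hh; have E : e = e' by exact: functional_extensionality_dep.
  subst e'; have E : h = h'.
  { apply: functional_extensionality_dep => x; apply: functional_extensionality_dep => y.
    exact: OverEq_eq. }
  by subst h'; rewrite (proof_irrelevance _ i i') (proof_irrelevance _ c c').
Qed.

Lemma VNat_HomEq {A B : VCategory V}
  (fo : A -> B) e h i c e' h' i' c' (go : A -> B) k l j d k' l' j' d'
  (α : VNat (@MkVFunctor A B fo e h i c) (@MkVFunctor A B go k l j d))
  (β : VNat (@MkVFunctor A B fo e' h' i' c') (@MkVFunctor A B go k' l' j' d')) :
  (forall x, e x = e' x) -> (forall x y, OverEq (h x y) (h' x y)) ->
  (forall x, k x = k' x) -> (forall x y, OverEq (l x y) (l' x y)) ->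
  (forall x, OverEq (vncomp α x) (vncomp β x)) ->
  HomEq (C := VFunctors A B) α β.
Proof.
  move=> he hh hk hl.
  have E : e = e' by exact: functional_extensionality_dep.
  subst e'; have E : h = h'.
  { apply: functional_extensionality_dep => x; apply: functional_extensionality_dep => y.
    exact: OverEq_eq. }
  have E' : k = k' by exact: functional_extensionality_dep.
  subst k'; have E' : l = l'.
  { apply: functional_extensionality_dep => x; apply: functional_extensionality_dep => y.
    exact: OverEq_eq. }
  subst h' l'; have ? := proof_irrelevance _ i i'; have ? := proof_irrelevance _ c c'.
  have ? := proof_irrelevance _ j j'; have ? := proof_irrelevance _ d d'.
  subst i' c' j' d' => H.
  have -> : α = β by apply: VNat_eq => x; apply: OverEq_eq; exact: H.
  exact: HomEq_refl.
Qed.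

Section TwoCategoryLaws.
Context {A B C D : VCategory V}.

Lemma vfhom_assoc (H : VFunctor C D) (G : VFunctor B C) (F : VFunctor A B) (x y : A) :
  OverEq (vfhom (vfunctor_comp H (vfunctor_comp G F)) x y)
         (vfhom (vfunctor_comp (vfunctor_comp H G) F) x y).
Proof.
  apply: (OverEq_trans (over_cast_eq _ _)).
  apply: (OverEq_trans (ocomp_congr (OverEq_refl _) (over_cast_eq _ _))).
  apply: OverEq_sym; apply: (OverEq_trans (over_cast_eq _ _)).
  apply: (OverEq_trans (ocomp_congr (over_cast_eq _ _) (OverEq_refl _))).
  exact: OverEq_sym (ocomp_assoc _ _ _).
Qed.

Lemma vfhom_idl (F : VFunctor A B) (x y : A) :
  OverEq (vfhom (vfunctor_comp (vfunctor_id B) F) x y) (vfhom F x y).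
Proof.
  apply: (OverEq_trans (over_cast_eq _ _)).
  apply: (OverEq_trans (ocomp_congr (over_cast_eq _ _) (OverEq_refl _))).
  exact: ocomp_oidl.
Qed.

Lemma vfhom_idr (F : VFunctor A B) (x y : A) :
  OverEq (vfhom (vfunctor_comp F (vfunctor_id A)) x y) (vfhom F x y).
Proof.
  apply: (OverEq_trans (over_cast_eq _ _)).
  apply: (OverEq_trans (ocomp_congr (OverEq_refl _) (over_cast_eq _ _))).
  exact: ocomp_oidr.
Qed.

Lemma vfunctor_assoc (H : VFunctor C D) (G : VFunctor B C) (F : VFunctor A B) :
  vfunctor_comp H (vfunctor_comp G F) = vfunctor_comp (vfunctor_comp H G) F.
Proof. apply: VFunctor_ext => [x|x y]; [exact: cmp_assoc | exact: vfhom_assoc]. Qed.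

Lemma vfunctor_idl (F : VFunctor A B) : vfunctor_comp (vfunctor_id B) F = F.
Proof.
  case E : F => [fo e h i c]; apply: VFunctor_ext => [x|x y]; first exact: cmp_idl.
  exact: (vfhom_idl (MkVFunctor i c)).
Qed.

Lemma vfunctor_idr (F : VFunctor A B) : vfunctor_comp F (vfunctor_id A) = F.
Proof.
  case E : F => [fo e h i c]; apply: VFunctor_ext => [x|x y]; first exact: cmp_idr.
  exact: (vfhom_idr (MkVFunctor i c)).
Qed.

Lemma vnat_hcomp_id (G : VFunctor B C) (F : VFunctor A B) :
  vnat_hcomp (vnat_id G) (vnat_id F) = vnat_id (vfunctor_comp G F).
Proof. by apply: VNat_eq => x /=; rewrite eres_eid eapp_eid lcomp_eid. Qed.

Lemma vnat_hcomp_comp {G G' G'' : VFunctor B C} {F F' F'' : VFunctor A B}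
  (β' : VNat G' G'') (β : VNat G G') (α' : VNat F' F'') (α : VNat F F') :
  vnat_hcomp (vnat_comp β' β) (vnat_comp α' α)
  = vnat_comp (vnat_hcomp β' α') (vnat_hcomp β α).
Proof.
  apply: VNat_eq => x /=; rewrite eres_lcomp eapp_lcomp -!lcomp_assoc; congr (lcomp _ _).
  by rewrite !lcomp_assoc vnat_elt -lcomp_rcomp.
Qed.

Lemma vnat_hcomp_assoc {H H' : VFunctor C D} {G G' : VFunctor B C} {F F' : VFunctor A B}
  (γ : VNat H H') (β : VNat G G') (α : VNat F F') :
  HomEq (C := VFunctors A D) (vnat_hcomp γ (vnat_hcomp β α)) (vnat_hcomp (vnat_hcomp γ β) α).
Proof.
  apply: VNat_HomEq => [x|x y|x|x y|x].
  - exact: cmp_assoc.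
  - exact: vfhom_assoc.
  - exact: cmp_assoc.
  - exact: vfhom_assoc.
  - rewrite /= eapp_lcomp eres_lcomp lcomp_assoc.
    apply: lcomp_congr; last exact: OverEq_sym (eapp_comp _ _ _).
    apply: lcomp_congr; first exact: OverEq_sym (eres_ounit_cmp _ _ _).
    exact: eapp_eres.
Qed.

Lemma vnat_hcomp_idl {F F' : VFunctor A B} (α : VNat F F') :
  HomEq (C := VFunctors A B) (vnat_hcomp (vnat_id (vfunctor_id B)) α) α.
Proof.
  case: F F' α => [fo e h i c] [go k l j d] α; apply: VNat_HomEq => [x|x y|x|x y|x].
  - exact: cmp_idl.
  - exact: (vfhom_idl (MkVFunctor i c)).
  - exact: cmp_idl.
  - exact: (vfhom_idl (MkVFunctor j d)).
  - rewrite /= eres_eid lcomp_eid; exact: eapp_id.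
Qed.

Lemma vncomp_hcomp_idr {F F' : VFunctor A B} (α : VNat F F') (x : A) :
  OverEq (vncomp (vnat_hcomp α (vnat_id (vfunctor_id A))) x) (vncomp α x).
Proof.
  have E : OverEq (eapp (vfhom F x x) (eid (idm (ext x)))) (eid (vfext F x)).
  { rewrite eapp_eid; apply: eid_congr; exact: cmp_idr. }
  apply: (OverEq_trans (lcomp_congr (eres_ounit_id _) E)).
  rewrite lcomp_rcomp rcomp_eid; exact: OverEq_refl.
Qed.

Lemma vnat_hcomp_idr {F F' : VFunctor A B} (α : VNat F F') :
  HomEq (C := VFunctors A B) (vnat_hcomp α (vnat_id (vfunctor_id A))) α.
Proof.
  case: F F' α => [fo e h i c] [go k l j d] α; apply: VNat_HomEq => [x|x y|x|x y|x].
  - exact: cmp_idr.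
  - exact: (vfhom_idr (MkVFunctor i c)).
  - exact: cmp_idr.
  - exact: (vfhom_idr (MkVFunctor j d)).
  - exact: vncomp_hcomp_idr.
Qed.
End TwoCategoryLaws.
End Functors.

Record TwoCategory : Type := MkTwoCategory {
  cell0 :> Type;
  cells : cell0 -> cell0 -> Category;
  id1 : forall a, cells a a;
  comp1 : forall a b c, cells b c -> cells a b -> cells a c;
  comp2 : forall a b c (g g' : cells b c) (f f' : cells a b),
    hom g g' -> hom f f' -> hom (comp1 g f) (comp1 g' f');
  comp2_id : forall a b c (g : cells b c) (f : cells a b),
    comp2 (idm g) (idm f) = idm (comp1 g f);
  comp2_cmp : forall a b c (g g' g'' : cells b c) (f f' f'' : cells a b)
      (β' : hom g' g'') (β : hom g g') (α' : hom f' f'') (α : hom f f'),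
    comp2 (β' ∘ β) (α' ∘ α) = comp2 β' α' ∘ comp2 β α;
  comp1_assoc : forall a b c d (h : cells c d) (g : cells b c) (f : cells a b),
    comp1 h (comp1 g f) = comp1 (comp1 h g) f;
  comp1_idl : forall a b (f : cells a b), comp1 (id1 b) f = f;
  comp1_idr : forall a b (f : cells a b), comp1 f (id1 a) = f;
  comp2_assoc : forall a b c d (h h' : cells c d) (g g' : cells b c) (f f' : cells a b)
      (γ : hom h h') (β : hom g g') (α : hom f f'),
    HomEq (comp2 γ (comp2 β α)) (comp2 (comp2 γ β) α);
  comp2_idl : forall a b (f f' : cells a b) (α : hom f f'), HomEq (comp2 (idm (id1 b)) α) α;
  comp2_idr : forall a b (f f' : cells a b) (α : hom f f'), HomEq (comp2 α (idm (id1 a))) α }.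
Arguments cells {t} a b : rename.
Arguments id1 {t} a : rename.
Arguments comp1 {t a b c} g f : rename.
Arguments comp2 {t a b c g g' f f'} β α : rename.

Record TwoFunctor (C D : TwoCategory) : Type := MkTwoFunctor {
  tf0 :> C -> D;
  tf1 : forall a b : C, Functor (cells a b) (cells (tf0 a) (tf0 b));
  tf_id1 : forall a : C, tf1 a a (id1 a) = id1 (tf0 a);
  tf_comp1 : forall (a b c : C) (g : cells b c) (f : cells a b),
    tf1 a c (comp1 g f) = comp1 (tf1 b c g) (tf1 a b f);
  tf_comp2 : forall (a b c : C) (g g' : cells b c) (f f' : cells a b)
      (β : hom g g') (α : hom f f'),
    HomEq (fmap (tf1 a c) (comp2 β α)) (comp2 (fmap (tf1 b c) β) (fmap (tf1 a b) α)) }.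
Arguments tf1 {C D} t {a b} : rename.

(** A strict 2-adjunction: isomorphisms of hom-categories, natural in [a] and [b] with respect
    to 1-cells and 2-cells. *)
Record TwoAdjunction {C D : TwoCategory} (L : TwoFunctor C D) (R : TwoFunctor D C) : Type :=
MkTwoAdjunction {
  adj_iso : forall (a : C) (b : D), IsoOfCategories (cells a (R b)) (cells (L a) b);
  adj_nat1 : forall (a a' : C) (b b' : D) (v : cells b b') (f : cells a (R b)) (u : cells a' a),
    ioc_to (adj_iso a' b') (comp1 (tf1 R v) (comp1 f u))
    = comp1 v (comp1 (ioc_to (adj_iso a b) f) (tf1 L u));
  adj_nat2 : forall (a a' : C) (b b' : D) (v v' : cells b b') (f f' : cells a (R b))
      (u u' : cells a' a) (ψ : hom v v') (φ : hom f f') (ω : hom u u'),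
    HomEq (fmap (ioc_to (adj_iso a' b')) (comp2 (fmap (tf1 R) ψ) (comp2 φ ω)))
          (comp2 ψ (comp2 (fmap (ioc_to (adj_iso a b)) φ) (fmap (tf1 L) ω))) }.
Arguments adj_iso {C D L R} t a b : rename.

Definition adj_unit {C D : TwoCategory} {L : TwoFunctor C D} {R : TwoFunctor D C}
  (adj : TwoAdjunction L R) (a : C) : cells a (R (L a)) :=
  ioc_from (adj_iso adj a (L a)) (id1 (L a)).

Definition adj_counit {C D : TwoCategory} {L : TwoFunctor C D} {R : TwoFunctor D C}
  (adj : TwoAdjunction L R) (b : D) : cells (L (R b)) b :=
  ioc_to (adj_iso adj (R b) b) (id1 (R b)).

Definition IsInternalEquivalence {C : TwoCategory} {a b : C} (f : cells a b) : Prop :=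
  exists g : cells b a,
    inhabited (Iso (id1 a) (comp1 g f)) /\ inhabited (Iso (comp1 f g) (id1 b)).

Definition eq_to_hom {C : Category} {a b : C} (e : a = b) : hom a b :=
  match e with eq_refl => idm a end.

Lemma HomEq_fmap {C D : Category} (F : Functor C D) {a b c d : C} (f : hom a b) (g : hom c d) :
  HomEq f g -> HomEq (fmap F f) (fmap F g).
Proof. case; exact: HomEq_refl. Qed.

Lemma HomEq_trans {C : Category} {a b c d a' b' : C}
  (f : hom a b) (g : hom c d) (h : hom a' b') : HomEq f g -> HomEq g h -> HomEq f h.
Proof. by move=> e; case: e h. Qed.

Definition two_functor_id (C : TwoCategory) : TwoFunctor C C.
Proof.
  refine (@MkTwoFunctor C C (fun a => a) (fun a b => functor_id (cells a b)) _ _ _).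
  - by [].
  - by [].
  - move=> *; exact: HomEq_refl.
Defined.

Definition two_functor_comp {C D E : TwoCategory} (G : TwoFunctor D E) (F : TwoFunctor C D) :
  TwoFunctor C E.
Proof.
  refine (@MkTwoFunctor C E (fun a => G (F a)) (fun a b => functor_comp (tf1 G) (tf1 F)) _ _ _).
  - by move=> a /=; rewrite !tf_id1.
  - by move=> a b c g f /=; rewrite !tf_comp1.
  - move=> a b c g g' f f' β α /=.
    apply: (HomEq_trans (HomEq_fmap (tf1 G) (tf_comp2 F β α))); exact: tf_comp2.
Defined.

Record PseudonaturalTransformation {C D : TwoCategory} (F G : TwoFunctor C D) : Type :=
MkPseudonaturalTransformation {
  pn0 : forall a : C, cells (F a) (G a);
  pn1 : forall (a b : C) (f : cells a b),
    Iso (comp1 (tf1 G f) (pn0 a)) (comp1 (pn0 b) (tf1 F f));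
  pn_nat : forall (a b : C) (f f' : cells a b) (α : hom f f'),
    fwd (pn1 f') ∘ comp2 (fmap (tf1 G) α) (idm (pn0 a))
    = comp2 (idm (pn0 b)) (fmap (tf1 F) α) ∘ fwd (pn1 f);
  pn_id1 : forall a : C, HomEq (fwd (pn1 (id1 a))) (idm (pn0 a));
  pn_comp1 : forall (a b c : C) (g : cells b c) (f : cells a b),
    HomEq (fwd (pn1 (comp1 g f)))
          (comp2 (fwd (pn1 g)) (idm (tf1 F f))
             ∘ eq_to_hom (comp1_assoc (tf1 G g) (pn0 b) (tf1 F f))
             ∘ comp2 (idm (tf1 G g)) (fwd (pn1 f))) }.
Arguments pn0 {C D F G} p a : rename.

Definition IsPseudonaturalEquivalence {C D : TwoCategory} {F G : TwoFunctor C D}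
  (σ : PseudonaturalTransformation F G) : Prop :=
  forall a : C, IsInternalEquivalence (pn0 σ a).

(** The adjunction is a biequivalence: its unit and counit are (the components of)
    pseudonatural equivalences between the composites and the identities. *)
Definition IsBiequivalence {C D : TwoCategory} {L : TwoFunctor C D} {R : TwoFunctor D C}
  (adj : TwoAdjunction L R) : Prop :=
  exists (η : PseudonaturalTransformation (two_functor_id C) (two_functor_comp R L))
         (ε : PseudonaturalTransformation (two_functor_comp L R) (two_functor_id D)),
    (forall a : C, pn0 η a = adj_unit adj a) /\
    (forall b : D, pn0 ε b = adj_counit adj b) /\
    IsPseudonaturalEquivalence η /\ IsPseudonaturalEquivalence ε.

(** The locally full sub-2-category on given 0-cells and 1-cells. *)
Section SubTwoCategory.
Context {C : TwoCategory} {P0 : C -> Prop} {P1 : forall a b : C, cells a b -> Prop}.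
Context (P1_id : forall a : C, P1 (id1 a)).
Context (P1_comp : forall (a b c : C) (g : cells b c) (f : cells a b),
  P1 g -> P1 f -> P1 (comp1 g f)).

Lemma sub_HomEq (K : Category) (P : K -> Prop) (a b c d : full_subcategory P)
  (f : hom a b) (g : hom c d) :
  HomEq (C := K) (a := proj1_sig a) (b := proj1_sig b) (c := proj1_sig c) (d := proj1_sig d) f g ->
  HomEq f g.
Proof.
  case: a b c d f g => [a pa] [b pb] [c pc] [d pd] /= f g h.
  case: h pc pd => pc pd.
  by rewrite (proof_irrelevance _ pc pa) (proof_irrelevance _ pd pb).
Qed.

Lemma sub_eq (K : Type) (P : K -> Prop) (a b : {x : K | P x}) :
  proj1_sig a = proj1_sig b -> a = b.
Proof.
  case: a b => [a pa] [b pb] /= e; subst b; by rewrite (proof_irrelevance _ pa pb).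
Qed.

Definition SubTwoCategory : TwoCategory.
Proof.
  refine (@MkTwoCategory {a : C | P0 a}
    (fun a b => full_subcategory (fun f : cells (proj1_sig a) (proj1_sig b) => P1 f))
    (fun a => exist _ (id1 (proj1_sig a)) (P1_id _))
    (fun a b c g f => exist _ (comp1 (proj1_sig g) (proj1_sig f))
                              (P1_comp (proj2_sig g) (proj2_sig f)))
    (fun a b c g g' f f' β α => comp2 (β : hom (proj1_sig g) (proj1_sig g')) α)
    _ _ _ _ _ _ _ _).
  - move=> a b c g f; exact: comp2_id.
  - move=> a b c g g' g'' f f' f'' β' β α' α; exact: comp2_cmp.
  - move=> a b c d h g f; apply: sub_eq; exact: comp1_assoc.
  - move=> a b f; apply: sub_eq; exact: comp1_idl.
  - move=> a b f; apply: sub_eq; exact: comp1_idr.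
  - move=> a b c d h h' g g' f f' γ β α; apply: sub_HomEq; exact: comp2_assoc.
  - move=> a b f f' α; apply: sub_HomEq; exact: comp2_idl.
  - move=> a b f f' α; apply: sub_HomEq; exact: comp2_idr.
Defined.

Definition SubTwoCategory_inclusion : TwoFunctor SubTwoCategory C.
Proof.
  refine (@MkTwoFunctor SubTwoCategory C (fun a => proj1_sig a)
    (fun a b => @MkFunctor (@cells SubTwoCategory a b) (cells (proj1_sig a) (proj1_sig b))
       (fun f => proj1_sig f) (fun f g α => α)
       (fun f => eq_refl) (fun f g h β α => eq_refl)) _ _ _).
  - by [].
  - by [].
  - move=> *; exact: HomEq_refl.
Defined.
End SubTwoCategory.
Arguments SubTwoCategory {C} P0 P1 P1_id P1_comp.
Arguments SubTwoCategory_inclusion {C} P0 P1 P1_id P1_comp.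

Definition VCAT {S : FinProdCategory} (V : IndexedMonoidalCategory S) : TwoCategory :=
  @MkTwoCategory (VCategory V) (@VFunctors S V) (@vfunctor_id S V) (@vfunctor_comp S V)
    (@vnat_hcomp S V) (@vnat_hcomp_id S V) (@vnat_hcomp_comp S V)
    (@vfunctor_assoc S V) (@vfunctor_idl S V) (@vfunctor_idr S V)
    (@vnat_hcomp_assoc S V) (@vnat_hcomp_idl S V) (@vnat_hcomp_idr S V).

Section Fibrations.
Context {S : FinProdCategory} {V : IndexedMonoidalCategory S}.

Definition Indexed {A B : VCategory V} (F : VFunctor A B) : Prop :=
  forall x : A, IsIdentity (vfext F x).

(** [r] is a restriction of [x] along [f], whose domain is the extent of [r]. *)
Definition IsRestriction {A : VCategory V} (x r : A) (f : hom (ext r) (ext x)) : Prop :=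
  exists (p : Over (pair f (idm (ext r))) unt (vhom r x))
         (q : Over (pair (idm (ext r)) f) unt (vhom x r)),
    lcomp (q : Elt (idm _) f unt) (p : Elt f (idm _) unt) = vid r /\
    lcomp (p : Elt f (idm _) unt) (q : Elt (idm _) f unt) = eid f.

Definition IsFibration (A : VCategory V) : Prop :=
  forall (x : A) (Y : S) (f : hom Y (ext x)),
    exists (r : A) (e : Y = ext r), IsRestriction (eq_rect Y (fun Z => hom Z (ext x)) f (ext r) e).

Lemma indexed_id (A : VCategory V) : Indexed (vfunctor_id A).
Proof. move=> x; exact: IsIdentity_idm. Qed.

Lemma indexed_comp (A B C : VCategory V) (G : VFunctor B C) (F : VFunctor A B) :
  Indexed G -> Indexed F -> Indexed (vfunctor_comp G F).
Proof.
  move=> hG hF x /=; case: (hG (F x)); rewrite cmp_idl; exact: hF.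
Qed.
End Fibrations.

Definition VFIB {S : FinProdCategory} (V : IndexedMonoidalCategory S) : TwoCategory :=
  SubTwoCategory (C := VCAT V) (@IsFibration S V) (@Indexed S V) (@indexed_id S V)
    (@indexed_comp S V).

Definition VFIB_inclusion {S : FinProdCategory} (V : IndexedMonoidalCategory S) :
  TwoFunctor (VFIB V) (VCAT V) :=
  SubTwoCategory_inclusion (C := VCAT V) (@IsFibration S V) (@Indexed S V) (@indexed_id S V)
    (@indexed_comp S V).

(* Main.v *)
From Corelib Require Import ssreflect.
From Stdlib Require Import FunctionalExtensionality ProofIrrelevance IndefiniteDescription.
Require Import Defs.

Set Implicit Arguments.
Unset Strict Implicit.
Unset Printing Implicit Defensive.

(** The theorem is an instance of a statement about a locally full sub-2-category of a
    2-category [D].  Suppose that every object [b] of [D] comes with an arrow [ε b : R b -> b]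
    out of an object of the sub-2-category such that composition with [ε b] is fully faithful
    on 2-cells, and that every arrow [a -> b] factors through [ε b] by exactly one arrow of the
    sub-2-category.  Composition with [ε b] is then an isomorphism of hom-categories, which
    makes [R] a right 2-adjoint with counit [ε].  By full faithfulness, [lift (id1 b)] is a
    pseudo-inverse of [ε b] in [D]; and the unit at [a] is an equivalence as soon as [ε a] is
    isomorphic to an arrow [r] of the sub-2-category, which is then its pseudo-inverse.

    For [𝒱]-categories, the objects of [Γ B] are pairs of an object [b] of [B] and an arrow
    [f : Z -> ext b], thought of as a formal restriction of [b] along [f]; its hom-objects are
    reindexed from those of [B].  Hence generalized elements of [Γ B] are generalized elements
    of [B] at other stages, and every law reduces to the one in [B].  If [A] is a fibration,
    choosing actual restrictions and conjugating [Γ A -> A] by the isomorphisms to them gives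
    the indexed functor [r]. *)

(** * Coreflections onto locally full sub-2-categories *)

Section HomEqCalculus.
Context {C : Category}.

Lemma HomEq_sym {a b c d : C} (f : hom a b) (g : hom c d) : HomEq f g -> HomEq g f.
Proof. case; exact: HomEq_refl. Qed.

Lemma HomEq_ends {a b c d : C} (f : hom a b) (g : hom c d) : HomEq f g -> a = c /\ b = d.
Proof. by case. Qed.

(** Packing the two end points into one pair turns [HomEq] into an equality of dependent pairs,
    which uniqueness of identity proofs ([inj_pair2]) unpacks. *)
Lemma HomEq_eq {a b : C} (f g : hom a b) : HomEq f g -> f = g.
Proof.
  pose P (ab : C * C) := hom (fst ab) (snd ab).
  have H : forall c d (k : hom c d), HomEq f k -> existT P (a, b) f = existT P (c, d) k.
  { by move=> c d k; case. }
  move=> h; exact: (inj_pair2 _ P _ _ _ (H _ _ _ h)).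
Qed.

Lemma HomEq_cmp {a b c a' b' c' : C} (g : hom b c) (f : hom a b) (g' : hom b' c') (f' : hom a' b') :
  HomEq g g' -> HomEq f f' -> HomEq (g ∘ f) (g' ∘ f').
Proof.
  move=> hg hf; have [eb ec] := HomEq_ends hg; have [ea _] := HomEq_ends hf; subst a' b' c'.
  by rewrite (HomEq_eq hg) (HomEq_eq hf); exact: HomEq_refl.
Qed.

Lemma HomEq_idm {a b : C} : a = b -> HomEq (idm a) (idm b).
Proof. move=> ->; exact: HomEq_refl. Qed.

Lemma eq_to_hom_cmp {a b c : C} (e : a = b) (e' : b = c) :
  eq_to_hom e' ∘ eq_to_hom e = eq_to_hom (eq_trans e e').
Proof. by case: c / e'; rewrite cmp_idl. Qed.

Lemma eq_to_hom_cmpl {a b c : C} (f : hom a b) (e : b = c) : HomEq (eq_to_hom e ∘ f) f.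
Proof. case: c / e; rewrite cmp_idl; exact: HomEq_refl. Qed.

Lemma eq_to_hom_cmpr {a b c : C} (f : hom b c) (e : a = b) : HomEq (f ∘ eq_to_hom e) f.
Proof. case: b / e f => f; rewrite cmp_idr; exact: HomEq_refl. Qed.

Lemma HomEq_eq_to_hom {a b c d : C} (e : a = b) (e' : c = d) :
  a = c -> HomEq (eq_to_hom e) (eq_to_hom e').
Proof. move=> ea; subst b c d; exact: HomEq_refl. Qed.

Definition eq_to_iso {a b : C} (e : a = b) : Iso a b.
Proof.
  refine (@MkIso C a b (eq_to_hom e) (eq_to_hom (eq_sym e)) _ _).
  - by case: b / e; rewrite cmp_idl.
  - by case: b / e; rewrite cmp_idl.
Defined.

Definition iso_sym {a b : C} (i : Iso a b) : Iso b a := MkIso (fwd_bwd i) (bwd_fwd i).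
End HomEqCalculus.

Definition sub_iso {C : Category} {P : C -> Prop} {a b : full_subcategory P}
  (i : Iso (proj1_sig a) (proj1_sig b)) : Iso a b :=
  @MkIso (full_subcategory P) a b (fwd i) (bwd i) (bwd_fwd i) (fwd_bwd i).

Lemma Functor_ext {C D : Category} (F G : Functor C D) :
  (forall a, F a = G a) -> (forall a b (f : hom a b), HomEq (fmap F f) (fmap G f)) -> F = G.
Proof.
  case: F G => [fo fm fi fc] [go gm gi gc] /= ho hm.
  have E : fo = go by exact: functional_extensionality_dep.
  subst go; have E : fm = gm.
  { do 3 (apply: functional_extensionality_dep => ?); exact: HomEq_eq. }
  by subst gm; rewrite (proof_irrelevance _ fi gi) (proof_irrelevance _ fc gc).
Qed.

(** * Whiskering in a 2-category *)

Section Whiskering.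
Context {D : TwoCategory}.

Lemma comp2_HomEq {a b c : D} {g g' k k' : cells b c} {f f' h h' : cells a b}
  (β : hom g g') (β' : hom k k') (α : hom f f') (α' : hom h h') :
  HomEq β β' -> HomEq α α' -> HomEq (comp2 β α) (comp2 β' α').
Proof. case; case; exact: HomEq_refl. Qed.

Lemma comp2_eq_to_hom_l {a b c : D} {g g' : cells b c} (e : g = g') (f : cells a b) :
  comp2 (eq_to_hom e) (idm f) = eq_to_hom (f_equal (fun k => comp1 k f) e).
Proof. case: g' / e; exact: comp2_id. Qed.

Lemma comp2_eq_to_hom_r {a b c : D} (g : cells b c) {f f' : cells a b} (e : f = f') :
  comp2 (idm g) (eq_to_hom e) = eq_to_hom (f_equal (comp1 g) e).
Proof. case: f' / e; exact: comp2_id. Qed.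

Lemma comp2_cmp_l {a b c : D} {g g' g'' : cells b c} (f : cells a b)
  (β' : hom g' g'') (β : hom g g') :
  comp2 (β' ∘ β) (idm f) = comp2 β' (idm f) ∘ comp2 β (idm f).
Proof. by rewrite -comp2_cmp cmp_idl. Qed.

Lemma comp2_cmp_r {a b c : D} (g : cells b c) {f f' f'' : cells a b}
  (α' : hom f' f'') (α : hom f f') :
  comp2 (idm g) (α' ∘ α) = comp2 (idm g) α' ∘ comp2 (idm g) α.
Proof. by rewrite -comp2_cmp cmp_idl. Qed.

Definition iso_whisker_r {a b c : D} {g g' : cells b c} (i : Iso g g') (f : cells a b) :
  Iso (comp1 g f) (comp1 g' f).
Proof.
  refine (@MkIso _ _ _ (comp2 (fwd i) (idm f)) (comp2 (bwd i) (idm f)) _ _).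
  - by rewrite -comp2_cmp_l bwd_fwd comp2_id.
  - by rewrite -comp2_cmp_l fwd_bwd comp2_id.
Defined.
End Whiskering.

(** Unit and counit are strictly natural, so their invertible 2-cells are identities transported
    along [nat1]. The unit and composition axioms then compare transported identities with a common
    source. *)
Definition strict_pseudonatural {C D : TwoCategory} {F G : TwoFunctor C D}
  (σ : forall a : C, cells (F a) (G a))
  (nat1 : forall (a b : C) (f : cells a b), comp1 (tf1 G f) (σ a) = comp1 (σ b) (tf1 F f))
  (nat2 : forall (a b : C) (f f' : cells a b) (α : hom f f'),
    HomEq (comp2 (fmap (tf1 G) α) (idm (σ a))) (comp2 (idm (σ b)) (fmap (tf1 F) α))) :
  PseudonaturalTransformation F G.
Proof.
  refine (@MkPseudonaturalTransformation C D F G σ (fun a b f => eq_to_iso (nat1 a b f)) _ _ _).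
  - move=> a b f f' α; apply: HomEq_eq => /=.
    apply: (HomEq_trans (eq_to_hom_cmpl _ _)); apply: (HomEq_trans (nat2 _ _ _ _ α)).
    exact/HomEq_sym/eq_to_hom_cmpr.
  - move=> a; apply: (HomEq_eq_to_hom _ (eq_refl (σ a))); by rewrite tf_id1 comp1_idl.
  - move=> a b c g f; rewrite /= comp2_eq_to_hom_l comp2_eq_to_hom_r !eq_to_hom_cmp.
    apply: HomEq_eq_to_hom; by rewrite tf_comp1 comp1_assoc.
Defined.

(** * The right 2-adjoint obtained from a universal counit *)

Section Coreflection.
Context {D : TwoCategory} {P0 : D -> Prop} {P1 : forall a b : D, cells a b -> Prop}.
Context (P1_id : forall a : D, P1 (id1 a)).
Context (P1_comp : forall (a b c : D) (g : cells b c) (f : cells a b),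
  P1 g -> P1 f -> P1 (comp1 g f)).
Context (R : D -> D) (R_P0 : forall b, P0 (R b)) (ε : forall b, cells (R b) b).
(** Full faithfulness is asked of all arrows into [R b]: [counit_equivalence] applies it to
    [comp1 (lift (id1 b)) (ε b)], for which [P1] is not assumed. *)
Context (whisker_inv : forall (a b : D) (f g : cells a (R b)),
  hom (comp1 (ε b) f) (comp1 (ε b) g) -> hom f g).
Context (whisker_invK : forall (a b : D) (f g : cells a (R b))
  (θ : hom (comp1 (ε b) f) (comp1 (ε b) g)), comp2 (idm (ε b)) (whisker_inv θ) = θ).
Context (whiskerK : forall (a b : D) (f g : cells a (R b)) (φ : hom f g),
  whisker_inv (comp2 (idm (ε b)) φ) = φ).
Context (lift : forall a b : D, cells a b -> cells a (R b)).
Context (lift_P1 : forall (a b : D) (f : cells a b), P1 (lift f)).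
Context (counit_lift : forall (a b : D) (f : cells a b), comp1 (ε b) (lift f) = f).
Context (lift_counit : forall (a b : D) (g : cells a (R b)), P1 g -> lift (comp1 (ε b) g) = g).
Context (retract : forall a : D, P0 a ->
  exists r : cells (R a) a, P1 r /\ inhabited (Iso r (ε a))).

Local Notation SubD := (SubTwoCategory P0 P1 P1_id P1_comp).
Local Notation inclusion := (SubTwoCategory_inclusion P0 P1 P1_id P1_comp).

Lemma P1_counit_inj {a b : D} (g g' : cells a (R b)) :
  P1 g -> P1 g' -> comp1 (ε b) g = comp1 (ε b) g' -> g = g'.
Proof. by move=> h h' e; rewrite -(lift_counit h) e lift_counit. Qed.

(** Unique factorisation identifies the end points, whence the four [P1] hypotheses; faithfulness
    then identifies the 2-cells. *)
Lemma whisker_inj {a b : D} {f g f' g' : cells a (R b)} (φ : hom f g) (φ' : hom f' g') :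
  P1 f -> P1 g -> P1 f' -> P1 g' ->
  HomEq (comp2 (idm (ε b)) φ) (comp2 (idm (ε b)) φ') -> HomEq φ φ'.
Proof.
  move=> hf hg hf' hg' h; have [ef eg] := HomEq_ends h.
  have ? := P1_counit_inj hf hf' ef; have ? := P1_counit_inj hg hg' eg; subst f' g'.
  rewrite -(whiskerK φ) -(whiskerK φ') (HomEq_eq h); exact: HomEq_refl.
Qed.

(** The lifts compose with [ε b] to [u] and [v] only propositionally, hence the two transports. *)
Definition lift2 {a b : D} {u v : cells a b} (θ : hom u v) : hom (lift u) (lift v) :=
  whisker_inv (eq_to_hom (eq_sym (counit_lift v)) ∘ θ ∘ eq_to_hom (counit_lift u)).

Lemma whisker_lift2 {a b : D} {u v : cells a b} (θ : hom u v) :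
  HomEq (comp2 (idm (ε b)) (lift2 θ)) θ.
Proof.
  rewrite whisker_invK; apply: (HomEq_trans (eq_to_hom_cmpr _ _)); exact: eq_to_hom_cmpl.
Qed.

(** A fully faithful functor reflects isomorphisms. *)
Definition iso_of_whisker {a b : D} {f g : cells a (R b)}
  (i : Iso (comp1 (ε b) f) (comp1 (ε b) g)) : Iso f g.
Proof.
  refine (@MkIso _ f g (whisker_inv (fwd i)) (whisker_inv (bwd i)) _ _).
  - by rewrite -(whiskerK (_ ∘ _)) comp2_cmp_r !whisker_invK bwd_fwd -comp2_id whiskerK.
  - by rewrite -(whiskerK (_ ∘ _)) comp2_cmp_r !whisker_invK fwd_bwd -comp2_id whiskerK.
Defined.

Definition coreflect0 (b : D) : SubD := exist _ (R b) (R_P0 b).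

(** Strict naturality of the counit forces this choice. *)
Definition coreflect1 {a b : D} (v : cells a b) : @cells SubD (coreflect0 a) (coreflect0 b) :=
  exist _ (lift (comp1 v (ε a))) (lift_P1 _).

Definition coreflect2 {a b : D} {v v' : cells a b} (ψ : hom v v') :
  hom (coreflect1 v) (coreflect1 v') := lift2 (comp2 ψ (idm (ε a))).

Lemma counit_coreflect1 {a b : D} (v : cells a b) :
  comp1 (ε b) (proj1_sig (coreflect1 v)) = comp1 v (ε a).
Proof. exact: counit_lift. Qed.

Lemma counit_coreflect2 {a b : D} {v v' : cells a b} (ψ : hom v v') :
  HomEq (comp2 (idm (ε b)) (coreflect2 ψ : hom (proj1_sig _) (proj1_sig _)))
        (comp2 ψ (idm (ε a))).
Proof. exact: whisker_lift2. Qed.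

Definition coreflect_cells (a b : D) :
  Functor (cells a b) (@cells SubD (coreflect0 a) (coreflect0 b)).
Proof.
  refine (@MkFunctor (cells a b) _ coreflect1 (@coreflect2 a b) _ _).
  - move=> v; apply: HomEq_eq; apply: sub_HomEq.
    apply: (@whisker_inj (R a) b); try exact: lift_P1.
    apply: (HomEq_trans (counit_coreflect2 _)); rewrite !comp2_id.
    apply: HomEq_idm; exact: eq_sym (counit_lift _).
  - move=> u v w ψ' ψ; apply: HomEq_eq; apply: sub_HomEq.
    apply: (@whisker_inj (R a) b); try exact: lift_P1.
    apply: (HomEq_trans (counit_coreflect2 _)); rewrite comp2_cmp_l /= comp2_cmp_r.
    apply: HomEq_sym; apply: HomEq_cmp; exact: counit_coreflect2.
Defined.

Definition coreflection : TwoFunctor D SubD.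
Proof.
  refine (@MkTwoFunctor D SubD coreflect0 coreflect_cells _ _ _).
  - move=> a; apply: sub_eq => /=; apply: P1_counit_inj; [exact: lift_P1 | exact: P1_id |].
    by rewrite counit_lift comp1_idl comp1_idr.
  - move=> a b c g f; apply: sub_eq => /=.
    apply: P1_counit_inj; [exact: lift_P1 | apply: P1_comp; exact: lift_P1 |].
    by rewrite counit_lift comp1_assoc counit_lift -!comp1_assoc counit_lift.
  - move=> a b c g g' f f' β α; apply: sub_HomEq => /=.
    apply: (@whisker_inj (R a) c); try exact: lift_P1; try (apply: P1_comp; exact: lift_P1).
    (* The counit is moved past [β], then past [α], until both sides are [comp2 β α] whiskered with
       [ε a]. *)
    apply: (HomEq_trans (counit_coreflect2 _)); apply: HomEq_sym.
    apply: (HomEq_trans (comp2_assoc _ _ _)).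
    apply: (HomEq_trans (comp2_HomEq (counit_coreflect2 _) (HomEq_refl _))).
    apply: (HomEq_trans (HomEq_sym (comp2_assoc _ _ _))).
    apply: (HomEq_trans (comp2_HomEq (HomEq_refl _) (counit_coreflect2 _))).
    exact: comp2_assoc.
Defined.

Definition counit_postcomp (a : SubD) (b : D) :
  Functor (@cells SubD a (coreflection b)) (cells (inclusion a) b).
Proof.
  refine (@MkFunctor (@cells SubD a (coreflection b)) (cells (inclusion a) b)
    (fun f => comp1 (ε b) (proj1_sig f))
    (fun f g (φ : hom (proj1_sig f) (proj1_sig g)) => comp2 (idm (ε b)) φ) _ _).
  - move=> f; exact: comp2_id.
  - move=> f g h ψ φ; exact: comp2_cmp_r.
Defined.

Definition lift_cells (a : SubD) (b : D) :
  Functor (cells (inclusion a) b) (@cells SubD a (coreflection b)).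
Proof.
  refine (@MkFunctor (cells (inclusion a) b) (@cells SubD a (coreflection b))
    (fun u => exist _ (lift u) (lift_P1 u))
    (fun u v θ => lift2 θ) _ _).
  - move=> u; apply: HomEq_eq; apply: sub_HomEq.
    apply: (@whisker_inj _ b); try exact: lift_P1.
    apply: (HomEq_trans (whisker_lift2 _)); rewrite comp2_id.
    apply: HomEq_idm; exact: eq_sym (counit_lift _).
  - move=> u v w ψ φ; apply: HomEq_eq; apply: sub_HomEq.
    apply: (@whisker_inj _ b); try exact: lift_P1.
    apply: (HomEq_trans (whisker_lift2 _)); rewrite /= comp2_cmp_r.
    apply: HomEq_sym; apply: HomEq_cmp; exact: whisker_lift2.
Defined.

Definition coreflection_iso (a : SubD) (b : D) :
  IsoOfCategories (@cells SubD a (coreflection b)) (cells (inclusion a) b).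
Proof.
  refine (@MkIsoOfCategories _ _ (counit_postcomp a b) (lift_cells a b) _ _).
  - apply: Functor_ext => [f|f g φ].
    + apply: sub_eq; exact: (lift_counit (proj2_sig f)).
    + apply: sub_HomEq; apply: (@whisker_inj _ b); try exact: lift_P1.
      * exact: (proj2_sig f).
      * exact: (proj2_sig g).
      * exact: whisker_lift2.
  - apply: Functor_ext => [u|u v θ]; [exact: counit_lift | exact: whisker_lift2].
Defined.

(** Naturality in [a] is associativity; naturality in [b] is strict naturality of [ε]. *)
Definition coreflection_adjunction : TwoAdjunction inclusion coreflection.
Proof.
  refine (@MkTwoAdjunction SubD D inclusion coreflection coreflection_iso _ _).
  - move=> a a' b b' v f u /=.
    by rewrite comp1_assoc counit_lift -!comp1_assoc.
  - move=> a a' b b' v v' f f' u u' ψ φ ω /=.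
    apply: (HomEq_trans (comp2_assoc _ _ _)).
    apply: (HomEq_trans (comp2_HomEq (counit_coreflect2 _) (HomEq_refl _))).
    apply: (HomEq_trans (HomEq_sym (comp2_assoc _ _ _))).
    apply: (comp2_HomEq (HomEq_refl _)); exact: comp2_assoc.
Defined.

Definition unit_pseudonatural :
  PseudonaturalTransformation (two_functor_id SubD) (two_functor_comp coreflection inclusion).
Proof.
  refine (@strict_pseudonatural SubD SubD (two_functor_id SubD)
    (two_functor_comp coreflection inclusion) (adj_unit coreflection_adjunction) _ _).
  - move=> a b f; apply: sub_eq => /=.
    apply: P1_counit_inj.
    + apply: P1_comp; exact: lift_P1.
    + apply: P1_comp; [exact: lift_P1 | exact: (proj2_sig f)].
    + by rewrite !comp1_assoc !counit_lift -comp1_assoc counit_lift comp1_idl comp1_idr.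
  - move=> a b f f' α; apply: sub_HomEq => /=.
    (* A triangle identity on 2-cells: the unit at [c] is [lift (id1 c)]. With it, both sides
       whisker to [α]. *)
    have counit_unit c : HomEq (comp2 (idm (ε c)) (idm (lift (id1 c)))) (idm (id1 c)).
    { rewrite comp2_id counit_lift; exact: HomEq_refl. }
    apply: (@whisker_inj (proj1_sig a) (proj1_sig b)).
    1,2: by apply: P1_comp; exact: lift_P1.
    1: by apply: P1_comp; [exact: lift_P1 | exact: (proj2_sig f)].
    1: by apply: P1_comp; [exact: lift_P1 | exact: (proj2_sig f')].
    apply: (HomEq_trans (comp2_assoc _ _ _)).
    apply: (HomEq_trans (comp2_HomEq (counit_coreflect2 _) (HomEq_refl _))).
    apply: (HomEq_trans (HomEq_sym (comp2_assoc _ _ _))).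
    apply: (HomEq_trans (comp2_HomEq (HomEq_refl _) (counit_unit _))).
    apply: (HomEq_trans (comp2_idr _)); apply: HomEq_sym.
    apply: (HomEq_trans (comp2_assoc _ _ _)).
    apply: (HomEq_trans (comp2_HomEq (counit_unit _) (HomEq_refl _))).
    exact: comp2_idl.
Defined.

Definition counit_pseudonatural :
  PseudonaturalTransformation (two_functor_comp inclusion coreflection) (two_functor_id D).
Proof.
  refine (@strict_pseudonatural D D (two_functor_comp inclusion coreflection)
    (two_functor_id D) ε _ _).
  - move=> a b f; exact: eq_sym (counit_coreflect1 f).
  - move=> a b f f' α; exact: HomEq_sym (counit_coreflect2 α).
Defined.

Lemma unit_equivalence (a : SubD) : IsInternalEquivalence (adj_unit coreflection_adjunction a).
Proof.
  have [r [r1 [i]]] := retract (proj2_sig a).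
  have e : comp1 (ε (proj1_sig a)) (lift (id1 (proj1_sig a))) = id1 (proj1_sig a).
  { exact: counit_lift. }
  exists (exist _ r r1); split; constructor.
  - apply: sub_iso; apply: iso_sym.
    exact: (iso_comp (eq_to_iso e) (iso_whisker_r i (lift (id1 (proj1_sig a))))). 
  (* After composition with [ε], the endomorphism unit after [r] becomes [r], and the identity
     becomes [ε]; these are isomorphic by [i]. *)
  - apply: sub_iso; apply: iso_of_whisker.
    apply: iso_comp (iso_comp _ i) _; apply: eq_to_iso; first by rewrite comp1_idr.
    by rewrite /= comp1_assoc e comp1_idl.
Qed.

Lemma counit_equivalence (b : D) : IsInternalEquivalence (ε b).
Proof.
  exists (lift (id1 b)); split; constructor.
  - apply: iso_of_whisker; apply: eq_to_iso.
    by rewrite comp1_assoc counit_lift comp1_idl comp1_idr.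
  - apply: eq_to_iso; exact: counit_lift.
Qed.

Theorem coreflection_biequivalence :
  exists (Γ : TwoFunctor D SubD) (adj : TwoAdjunction inclusion Γ),
    (forall a : SubD, IsInternalEquivalence (adj_unit adj a)) /\
    (forall b : D, IsInternalEquivalence (adj_counit adj b)) /\
    IsBiequivalence adj.
Proof.
  have counitE b : adj_counit coreflection_adjunction b = ε b by exact: comp1_idr.
  exists coreflection, coreflection_adjunction; split; first exact: unit_equivalence.
  split; first by move=> b; rewrite counitE; exact: counit_equivalence.
  exists unit_pseudonatural, counit_pseudonatural; split=> //; split=> [b|]; first by rewrite counitE.
  split=> [a|b]; [exact: unit_equivalence | exact: counit_equivalence].
Qed.
End Coreflection.

(** * The free fibration [Γ B] *)

Section FreeRestrictions.
Context {S : FinProdCategory} {V : IndexedMonoidalCategory S}.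

(** A formal restriction of [gbase] along [gmap]. *)
Record GammaOb (B : VCatData V) : Type := MkGammaOb {
  gbase : B;
  gext : S;
  gmap : hom gext (ext gbase) }.

Section Data.
Context (B : VCategory V).
Implicit Types p q r : GammaOb B.

Definition gamma_hom p q : V (gext q × gext p) :=
  pull (prdm (gmap q) (gmap p)) (vhom (gbase p) (gbase q)).

(** The cartesian morphism: a morphism over [f] into [N] is by definition an arrow into [pull f N],
    so the identity arrow serves. *)
Definition gamma_cart p q :
  Over (prdm (gmap q) (gmap p)) (gamma_hom p q) (vhom (gbase p) (gbase q)) := idm _.

(* Stated without [eapp], which presupposes [gamma_data]. *)
Definition gamma_push {p q} {T : S} {b : hom T (gext q)} {a : hom T (gext p)} {M : V T}
  (m : Over (pair b a) M (gamma_hom p q)) : Elt (gmap q ∘ b) (gmap p ∘ a) M :=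
  over_cast (prdm_pair _ _ _ _) (ocomp (gamma_cart p q) m).

(** Factorisation through [gamma_cart], inverse to [gamma_push]. *)
Definition gamma_pull {p q} {T : S} {b : hom T (gext q)} {a : hom T (gext p)} {M : V T}
  (m : Elt (y := gbase q) (x := gbase p) (gmap q ∘ b) (gmap p ∘ a) M) :
  Over (pair b a) M (gamma_hom p q) :=
  olift (over_cast (eq_sym (prdm_pair _ _ _ _)) m).

(** Identities and composition are pulled back from [B], so that [gamma_cart] preserves them by
    [push_pull] alone. *)
Definition gamma_data : VCatData V :=
  @MkVCatData S V (GammaOb B) (@gext B) gamma_hom
    (fun p => gamma_pull (eid (gmap p ∘ idm (gext p))))
    (fun p q r => gamma_pull (b := pr1) (a := pr2 ∘ pr2)
      (ecomp (gamma_push (b := pr1) (a := pr1 ∘ pr2) (idm (pull pr12 (gamma_hom q r))))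
             (gamma_push (b := pr1 ∘ pr2) (a := pr2 ∘ pr2) (idm (pull pr23 (gamma_hom p q)))))).

Local Notation push m := (eapp (A := gamma_data) (B := B) (gamma_cart _ _) m).

Lemma push_pull {p q : gamma_data} {T : S} {b : hom T (ext q)} {a : hom T (ext p)} {M : V T}
  (m : Elt (gmap q ∘ b) (gmap p ∘ a) M) :
  push (gamma_pull m : Elt b a M) = m.
Proof.
  apply: OverEq_eq; apply: (OverEq_trans (eapp_eq _ _)).
  rewrite /gamma_pull /gamma_cart ocomp_olift; exact: over_cast_eq.
Qed.

Lemma push_inj {p q : gamma_data} {T : S} {b : hom T (ext q)} {a : hom T (ext p)} {M : V T}
  (m m' : Elt b a M) : push m = push m' -> m = m'.
Proof.
  move=> e; apply: ocart_inj; apply: OverEq_eq.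
  apply: (OverEq_trans (OverEq_sym (eapp_eq (A := gamma_data) (B := B) (gamma_cart p q) m))).
  rewrite e; exact: eapp_eq.
Qed.

Lemma push_vid (p : gamma_data) :
  push (vid p : Elt (idm (ext p)) (idm (ext p)) unt) = eid (gmap p ∘ idm (ext p)).
Proof. exact: push_pull. Qed.

Lemma push_vcomp (p q r : gamma_data) :
  push (vcomp p q r : Elt pr1 (pr2 ∘ pr2) _)
  = ecomp (push (gen pr1 (pr1 ∘ pr2))) (push (gen (pr1 ∘ pr2) (pr2 ∘ pr2))).
Proof. exact: push_pull. Qed.

(** [eapp_eid] and [eapp_ecomp] presuppose a functor between [𝒱]-categories. Their arguments are
    repeated here and in [push_ecomp], since the laws of [gamma] are deduced from the results. *)
Lemma push_eid {p : gamma_data} {T : S} (a : hom T (ext p)) :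
  push (eid a) = eid (gmap p ∘ a).
Proof.
  have h : OverEq (eid a) (eres (vid p : Elt (idm (ext p)) (idm (ext p)) unt) (ounit a)).
  { apply: (OverEq_trans (eid_eq a)); apply: OverEq_sym; exact: eres_eq. }
  apply: OverEq_eq; apply: (OverEq_trans (eapp_congr _ h)).
  apply: (OverEq_trans (eapp_eres _ _ _)).
  rewrite push_vid eres_eid -cmp_assoc cmp_idl; exact: OverEq_refl.
Qed.

Lemma push_ecomp {p q r : gamma_data} {T : S}
  {c : hom T (ext r)} {b : hom T (ext q)} {a : hom T (ext p)} {M N : V T}
  (m : Elt c b M) (n : Elt b a N) : push (ecomp m n) = ecomp (push m) (push n).
Proof.
  have [m' [n' [em en]]] := ecomp_factors m n.
  have h : OverEq (ecomp m n) (eres (vcomp p q r : Elt pr1 (pr2 ∘ pr2) _) (otens m' n')).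
  { apply: (OverEq_trans (ecomp_spec em en)); apply: OverEq_sym; exact: eres_eq. }
  apply: OverEq_eq; apply: (OverEq_trans (eapp_congr _ h)).
  apply: (OverEq_trans (eapp_eres _ _ _)).
  rewrite push_vcomp eres_ecomp; apply: ecomp_congr.
  - apply: (OverEq_trans (OverEq_sym (eapp_eres _ _ _))); apply: eapp_congr.
    exact: (OverEq_trans (eres_eq _ _) em).
  - apply: (OverEq_trans (OverEq_sym (eapp_eres _ _ _))); apply: eapp_congr.
    exact: (OverEq_trans (eres_eq _ _) en).
Qed.

Lemma ecomp_eid_l {x y : B} {T : S} {b : hom T (ext y)} {a : hom T (ext x)} {M : V T}
  (m : Elt b a M) : ecomp (eid b) m = m ∘ fwd (lunit M).
Proof. by rewrite -{2}(lcomp_eid m) /lcomp -cmp_assoc bwd_fwd cmp_idr. Qed.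

Lemma ecomp_eid_r {x y : B} {T : S} {b : hom T (ext y)} {a : hom T (ext x)} {M : V T}
  (m : Elt b a M) : ecomp m (eid a) = m ∘ fwd (runit M).
Proof. by rewrite -{2}(rcomp_eid m) /rcomp -cmp_assoc bwd_fwd cmp_idr. Qed.

Definition gamma : VCategory V.
Proof.
  refine (@MkVCategory S V gamma_data _ _ _).
  - move=> x y z w T d c b a; apply: push_inj.
    rewrite eapp_pre !push_ecomp; exact: ecomp_assoc.
  - move=> x y b a; apply: push_inj.
    rewrite eapp_pre push_ecomp push_eid; exact: ecomp_eid_l.
  - move=> x y b a; apply: push_inj.
    rewrite eapp_pre push_ecomp push_eid; exact: ecomp_eid_r.
Defined.

Definition gamma_counit : VFunctor gamma B :=
  @MkVFunctor S V gamma B (@gbase B) (@gmap B) gamma_cart push_vid push_vcomp.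
End Data.

(** * Full faithfulness of composition with the counit *)

Lemma vncomp_whisker_counit {A B : VCategory V} {G H : VFunctor A (gamma B)}
  (φ : VNat G H) (x : A) :
  vncomp (vnat_hcomp (vnat_id (gamma_counit B)) φ) x
  = eapp (A := gamma B) (gamma_cart (G x) (H x)) (vncomp φ x).
Proof. by rewrite /= eres_eid lcomp_eid. Qed.

(** Whiskering with the counit pushes each component, and pushing is bijective on elements;
    naturality may be tested after pushing. *)
Definition gamma_whisker_inv {A B : VCategory V} {G H : VFunctor A (gamma B)}
  (θ : VNat (vfunctor_comp (gamma_counit B) G) (vfunctor_comp (gamma_counit B) H)) : VNat G H.
Proof.
  refine (@MkVNat S V A (gamma B) G H (fun x => gamma_pull (vncomp θ x)) _).
  move=> x y b a; apply: push_inj.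
  rewrite (eapp_lcomp (gamma_counit B)) (eapp_rcomp (gamma_counit B)).
  have up (z : A) (T : S) (c : hom T (ext z)) :
    OverEq (eapp (A := gamma B) (gamma_cart (G z) (H z))
             (eres (gamma_pull (vncomp θ z) : Elt (A := gamma B)
               (vfext H z) (vfext G z) unt) (ounit c)))
           (eres (vncomp θ z) (ounit c)).
  { apply: (OverEq_trans (eapp_eres _ _ _)); rewrite (push_pull (vncomp θ z)); exact: OverEq_refl. }
  apply: OverEq_eq.
  apply: (OverEq_trans (lcomp_congr (up _ _ _) (OverEq_sym (eapp_comp _ _ _)))).
  apply: OverEq_trans (rcomp_congr (eapp_comp _ _ _) (OverEq_sym (up _ _ _))).
  rewrite -(vnat_elt θ (gen b a)); exact: OverEq_refl.
Defined.

Lemma gamma_whisker_invK {A B : VCategory V} {G H : VFunctor A (gamma B)}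
  (θ : VNat (vfunctor_comp (gamma_counit B) G) (vfunctor_comp (gamma_counit B) H)) :
  vnat_hcomp (vnat_id (gamma_counit B)) (gamma_whisker_inv θ) = θ.
Proof. apply: VNat_eq => x; rewrite vncomp_whisker_counit; exact: push_pull. Qed.

Lemma gamma_whiskerK {A B : VCategory V} {G H : VFunctor A (gamma B)} (φ : VNat G H) :
  gamma_whisker_inv (vnat_hcomp (vnat_id (gamma_counit B)) φ) = φ.
Proof.
  apply: VNat_eq => x; apply: push_inj; rewrite -[RHS]vncomp_whisker_counit; exact: push_pull.
Qed.

(** * Unique indexed factorisation through the counit *)

Definition gamma_lift_hom {A B : VCategory V} (F : VFunctor A B) (x y : A) :
  Over (prdm (idm (ext y)) (idm (ext x))) (vhom x y)
    (gamma_hom (MkGammaOb (vfext F x)) (MkGammaOb (vfext F y))).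
Proof.
  refine (olift (over_cast _ (vfhom F x y))); abstract by rewrite prdm_cmp !cmp_idr.
Defined.

Lemma cart_lift_hom {A B : VCategory V} (F : VFunctor A B) (x y : A) :
  OverEq (ocomp (gamma_cart (MkGammaOb (vfext F x)) (MkGammaOb (vfext F y)))
            (gamma_lift_hom F x y)) (vfhom F x y).
Proof. rewrite /gamma_lift_hom /gamma_cart ocomp_olift; exact: over_cast_eq. Qed.

Lemma push_lift_hom {A B : VCategory V} (F : VFunctor A B) {x y : A} {T : S}
  {b : hom T (ext y)} {a : hom T (ext x)} {M : V T} (m : Elt b a M) :
  OverEq (eapp (A := gamma B) (gamma_cart (MkGammaOb (vfext F x)) (MkGammaOb (vfext F y)))
            (eapp (B := gamma B) (gamma_lift_hom F x y) m))
         (eapp (vfhom F x y) m).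
Proof.
  apply: (OverEq_trans (eapp_eq _ _)).
  apply: (OverEq_trans (ocomp_congr (OverEq_refl _) (eapp_eq _ _))).
  apply: (OverEq_trans (ocomp_assoc _ _ _)).
  apply: (OverEq_trans (ocomp_congr (cart_lift_hom F x y) (OverEq_refl _))).
  exact/OverEq_sym/eapp_eq.
Qed.

(** The extent map [vfext F x] moves from the functor into the object: [x] goes to the formal
    restriction of [F x] along it, whose extent is that of [x]. *)
Definition gamma_lift {A B : VCategory V} (F : VFunctor A B) : VFunctor A (gamma B).
Proof.
  refine (@MkVFunctor S V A (gamma B) (fun x => MkGammaOb (vfext F x)) (fun x => idm (ext x))
    (gamma_lift_hom F) _ _).
  - move=> x; apply: push_inj; apply: OverEq_eq.
    apply: (OverEq_trans (push_lift_hom _ _)).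
    rewrite vf_id push_eid; apply: eid_congr; by rewrite /= cmp_idl.
  - move=> x y z; apply: push_inj; apply: OverEq_eq.
    apply: (OverEq_trans (push_lift_hom _ _)).
    rewrite vf_comp push_ecomp; apply: ecomp_congr; exact: OverEq_sym (push_lift_hom _ _).
Defined.

Lemma gamma_lift_indexed {A B : VCategory V} (F : VFunctor A B) : Indexed (gamma_lift F).
Proof. move=> x; exact: IsIdentity_idm. Qed.

Lemma gamma_counit_lift {A B : VCategory V} (F : VFunctor A B) :
  vfunctor_comp (gamma_counit B) (gamma_lift F) = F.
Proof.
  case: F => fo e h i c; apply: VFunctor_ext => [x|x y]; first exact: cmp_idr.
  apply: (OverEq_trans (over_cast_eq _ _)); exact: (cart_lift_hom (MkVFunctor i c)).
Qed.

(** The codomains of [h x y] and [h' x y] differ until [fe] and [fe'] are identified; after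
    [gamma_cart] both land in one hom-object of [B], where they can be compared. *)
Lemma VFunctor_gamma_ext {A B : VCategory V} (fb : A -> B)
  (fe fe' : forall x, hom (ext x) (ext (fb x))) e h i c e' h' i' c' :
  (forall x, fe x = fe' x) -> (forall x, e x = e' x) ->
  (forall x y, OverEq (ocomp (gamma_cart (MkGammaOb (fe x)) (MkGammaOb (fe y))) (h x y))
                      (ocomp (gamma_cart (MkGammaOb (fe' x)) (MkGammaOb (fe' y))) (h' x y))) ->
  @MkVFunctor S V A (gamma B) (fun x => MkGammaOb (fe x)) e h i c
  = @MkVFunctor S V A (gamma B) (fun x => MkGammaOb (fe' x)) e' h' i' c'.
Proof.
  move=> hfe he; have E : fe = fe' by exact: functional_extensionality_dep.
  subst fe'; have E : e = e' by exact: functional_extensionality_dep.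
  subst e' => hh; apply: VFunctor_ext => [//|x y].
  rewrite (ocart_inj (OverEq_eq (hh x y))); exact: OverEq_refl.
Qed.

(** An indexed functor preserves extents only propositionally; here they are made equal
    judgmentally. *)
Lemma indexed_gamma_ind {A B : VCategory V}
  (P : forall fo : A -> gamma B, (forall x, hom (ext x) (ext (fo x))) -> Prop) :
  (forall (fb : A -> B) (fe : forall x, hom (ext x) (ext (fb x))),
    P (fun x => MkGammaOb (fe x)) (fun x => idm (ext x))) ->
  forall fo e, (forall x, IsIdentity (e x)) -> P fo e.
Proof.
  move=> H fo e he.
  (* Object and extent map are packed together so that one rewriting replaces both. Since [e x] is
     an identity, precomposing [gmap (fo x)] with it changes nothing. *)
  pose Q (x : A) := {p : gamma B & hom (ext x) (ext p)}.
  pose t (x : A) : Q x := existT _ (fo x) (e x).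
  pose t' (x : A) : Q x :=
    existT (fun p : gamma B => hom (ext x) (ext p)) (MkGammaOb (gmap (fo x) ∘ e x)) (idm (ext x)).
  have E : t' = t.
  { apply: functional_extensionality_dep => x; rewrite /t /t'.
    case: (fo x) (e x) (he x) => b Z f /= i hi; move: f.
    case: Z i / hi => f; by rewrite cmp_idr. }
  change (P (fun x => projT1 (t x)) (fun x => projT2 (t x))).
  rewrite -E; exact: H.
Qed.

Lemma gamma_lift_counit {A B : VCategory V} (G : VFunctor A (gamma B)) :
  Indexed G -> gamma_lift (vfunctor_comp (gamma_counit B) G) = G.
Proof.
  case: G => fo e h i c; rewrite /Indexed /= => he; move: fo e he h i c.
  apply: indexed_gamma_ind => fb fe h i c.
  apply: VFunctor_gamma_ext => [x|//|x y]; first exact: cmp_idr.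
  apply: (OverEq_trans (cart_lift_hom _ _ _)); exact: over_cast_eq.
Qed.

Lemma gamma_fibration (B : VCategory V) : IsFibration (gamma B).
Proof.
  move=> x Y f; pose r : gamma B := MkGammaOb (gmap x ∘ f).
  exists r, eq_refl => /=.
  have ep : pair (gmap x ∘ f) (gmap x ∘ f) = pair (gmap x ∘ f) (gmap x ∘ f ∘ idm Y).
  { by rewrite cmp_idr. }
  have eq : pair (gmap x ∘ f) (gmap x ∘ f) = pair (gmap x ∘ f ∘ idm Y) (gmap x ∘ f).
  { by rewrite cmp_idr. }
  (* [x] and [r] share their base, so both comparison morphisms are the identity of [gbase x]
     reindexed along [gmap x ∘ f]. *)
  exists (gamma_pull (p := r) (q := x) (b := f) (a := idm Y) (over_cast ep (eid (gmap x ∘ f)))).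
  exists (gamma_pull (p := x) (q := r) (b := idm Y) (a := f) (over_cast eq (eid (gmap x ∘ f)))).
  split; apply: push_inj; rewrite (eapp_lcomp (gamma_counit B)) !push_pull; apply: OverEq_eq;
    apply: (OverEq_trans (lcomp_congr (over_cast_eq _ _) (over_cast_eq _ _))); rewrite lcomp_eid.
  - apply: (OverEq_trans (eid_congr (eq_sym (cmp_idr (gmap r))))).
    rewrite -(push_vid r); exact: OverEq_refl.
  - rewrite -(push_eid (p := x) f); exact: OverEq_refl.
Qed.

End FreeRestrictions.

(** * Transport of functors along isomorphisms of objects *)

(** Mirror image of [lunit_tens]: tensoring with [unt] is faithful, and the tensored equation
    follows from the pentagon, the triangle and naturality. *)
Lemma runit_tens {M : MonoidalCategory} (a b : M) :
  (idm a ⊠ fwd (runit b)) ∘ fwd (assoc a b unt) = fwd (runit (a ⊗ b)).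
Proof.
  apply: tens_faithful_r; apply: (iso_mono (assoc a b unt)).
  rewrite -triangle -(tens_id a b) cmp_assoc assoc_nat -cmp_assoc pentagon.
  rewrite !cmp_assoc -tens_idl_cmp triangle -assoc_nat tens_idr_cmp.
  by rewrite !cmp_assoc.
Qed.

Lemma runit_tens_bwd {M : MonoidalCategory} (a b : M) :
  fwd (assoc a b unt) ∘ bwd (runit (a ⊗ b)) = idm a ⊠ bwd (runit b).
Proof.
  apply: (iso_mono (iso_tens (iso_id a) (runit b))) => /=.
  by rewrite cmp_assoc runit_tens -tens_cmp !fwd_bwd cmp_idl tens_id.
Qed.

Section Transport.
Context {S : FinProdCategory} {V : IndexedMonoidalCategory S}.

Section Balanced.
Context {A : VCategory V} {x y z w : A} {T : S} {d : hom T (ext w)} {c : hom T (ext z)}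
  {b : hom T (ext y)} {a : hom T (ext x)} {M N : V T}.

Lemma lcomp_ecomp (l : Elt d c unt) (m : Elt c b M) (n : Elt b a N) :
  lcomp l (ecomp m n) = ecomp (lcomp l m) n.
Proof.
  by rewrite /lcomp ecomp_prel ecomp_assoc -!cmp_assoc lunit_tens_bwd.
Qed.

Lemma rcomp_ecomp (l : Elt d c M) (m : Elt c b N) (n : Elt b a unt) :
  rcomp (ecomp l m) n = ecomp l (rcomp m n).
Proof.
  by rewrite /rcomp ecomp_prer ecomp_assoc -!cmp_assoc runit_tens_bwd.
Qed.

(** This lets an inverse pair between two factors of a composite meet and cancel. *)
Lemma ecomp_balanced (l : Elt d c M) (m : Elt c b unt) (n : Elt b a N) :
  ecomp (rcomp l m) n = ecomp l (lcomp m n).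
Proof.
  by rewrite /rcomp /lcomp ecomp_prel ecomp_prer ecomp_assoc -!cmp_assoc triangle_bwd.
Qed.
End Balanced.

(** * Conjugation of a functor by isomorphisms *)

Section TransportedFunctor.
Context {A B : VCategory V} (F : VFunctor A B) (g : A -> B).
Context (i : forall x : A, hom (ext x) (ext (g x))).
Context (P : forall x : A, Elt (y := F x) (x := g x) (vfext F x) (i x) unt).
Context (Q : forall x : A, Elt (y := g x) (x := F x) (i x) (vfext F x) unt).
Context (QP : forall x : A, lcomp (Q x) (P x) = eid (i x)).
Context (PQ : forall x : A, lcomp (P x) (Q x) = eid (vfext F x)).

(** The conjugate [Q y ∘ F m ∘ P x], running from [g x] through [F x] and [F y] to [g y]. *)
Definition conj_elt {x y : A} {T : S} {b : hom T (ext y)} {a : hom T (ext x)} {M : V T}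
  (m : Elt b a M) : Elt (i y ∘ b) (i x ∘ a) M :=
  lcomp (eres (Q y) (ounit b)) (rcomp (eapp (vfhom F x y) m) (eres (P x) (ounit a))).

(** Unlike [gen pr1 pr2], whose shape is a reindexing of [vhom x y], this has shape [vhom x y]
    itself, so that its conjugate is a morphism out of the hom-object. *)
Definition universal_elt (x y : A) : Elt pr1 pr2 (vhom x y) :=
  over_cast (eq_trans (pair_unique (idm _)) (f_equal2 (@pair S _ _ _) (cmp_idr _) (cmp_idr _)))
    (oid (vhom x y)).

Lemma eres_universal_elt {x y : A} {T : S} {b : hom T (ext y)} {a : hom T (ext x)} {M : V T}
  (m : Elt b a M) : OverEq (eres (universal_elt x y) (m : Over (pair b a) M (vhom x y))) m.
Proof.
  apply: (OverEq_trans (eres_eq _ _)).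
  apply: (OverEq_trans (ocomp_congr (over_cast_eq _ _) (OverEq_refl _))); exact: ocomp_oidl.
Qed.

Definition transport_hom (x y : A) : Over (prdm (i y) (i x)) (vhom x y) (vhom (g x) (g y)) :=
  conj_elt (universal_elt x y).

Lemma conj_elt_congr {x y : A} {T : S} {b b' : hom T (ext y)} {a a' : hom T (ext x)} {M : V T}
  {m : Elt b a M} {m' : Elt b' a' M} : OverEq m m' -> OverEq (conj_elt m) (conj_elt m').
Proof.
  move=> h; have [eb ea] := pair_inj (f_equal (@projT1 _ _) h : pair b a = pair b' a').
  subst b' a'; rewrite (OverEq_eq h); exact: OverEq_refl.
Qed.

(** A Yoneda argument: every element is a reindexing of [universal_elt], and conjugation commutes
    with reindexing. *)
Lemma eapp_transport {x y : A} {T : S} {b : hom T (ext y)} {a : hom T (ext x)} {M : V T}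
  (m : Elt b a M) : eapp (transport_hom x y) m = conj_elt m.
Proof.
  apply: OverEq_eq; apply: (OverEq_trans (eapp_eq _ _)).
  apply: (OverEq_trans (OverEq_sym (eres_eq (conj_elt (universal_elt x y)) _))).
  rewrite /conj_elt eres_lcomp eres_rcomp; apply: lcomp_congr.
  { apply: (OverEq_trans (eres_ounit_cmp _ _ _)); rewrite pr1_pair; exact: OverEq_refl. }
  apply: rcomp_congr.
  - apply: (OverEq_trans (OverEq_sym (eapp_eres _ _ _))); exact: eapp_congr (eres_universal_elt m).
  - apply: (OverEq_trans (eres_ounit_cmp _ _ _)); rewrite pr2_pair; exact: OverEq_refl.
Qed.

(** The inner [P y] and [Q y] are brought together by [ecomp_balanced] and cancel by [PQ]. *)
Lemma conj_elt_ecomp {x y z : A} {T : S} {c : hom T (ext z)} {b : hom T (ext y)} {a : hom T (ext x)}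
  {M N : V T} (m : Elt c b M) (n : Elt b a N) : conj_elt (ecomp m n) = ecomp (conj_elt m) (conj_elt n).
Proof.
  rewrite /conj_elt eapp_ecomp rcomp_ecomp lcomp_ecomp -lrcomp_assoc ecomp_balanced lcomp_assoc.
  by rewrite -eres_lcomp PQ eres_eid lcomp_eid.
Qed.

Lemma conj_elt_eid {x : A} {T : S} (a : hom T (ext x)) : conj_elt (eid a) = eid (i x ∘ a).
Proof.
  by rewrite /conj_elt eapp_eid -eres_eid -lcomp_rcomp -eres_lcomp lcomp_eid -eres_lcomp QP eres_eid.
Qed.

Definition transport : VFunctor A B.
Proof.
  refine (@MkVFunctor S V A B g i transport_hom _ _).
  - move=> x; rewrite eapp_transport -conj_elt_eid.
    apply: OverEq_eq; exact: conj_elt_congr (OverEq_sym (eid_idm x)).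
  - move=> x y z; rewrite !eapp_transport -conj_elt_ecomp.
    apply: OverEq_eq; exact: conj_elt_congr (vcomp_gen x y z).
Defined.

Definition transport_iso : Iso (C := VFunctors A B) transport F.
Proof.
  have p x y : lcomp (eres (P y) (ounit pr1)) (eapp (vfhom transport x y) (gen pr1 pr2))
    = rcomp (eapp (vfhom F x y) (gen pr1 pr2)) (eres (P x) (ounit pr2)).
  { by rewrite eapp_transport /conj_elt lcomp_assoc -eres_lcomp PQ eres_eid lcomp_eid. }
  have q x y : lcomp (eres (Q y) (ounit pr1)) (eapp (vfhom F x y) (gen pr1 pr2))
    = rcomp (eapp (vfhom transport x y) (gen pr1 pr2)) (eres (Q x) (ounit pr2)).
  { by rewrite eapp_transport /conj_elt lrcomp_assoc rcomp_assoc -eres_lcomp PQ eres_eid rcomp_eid. }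
  refine (@MkIso (VFunctors A B) transport F (@MkVNat _ _ A B transport F P p)
            (@MkVNat _ _ A B F transport Q q) _ _).
  - apply: VNat_eq; exact: QP.
  - apply: VNat_eq; exact: PQ.
Defined.
End TransportedFunctor.

(** * Actual restrictions in a fibration *)

Lemma restriction_choice {A : VCategory V} (fibA : IsFibration A) (o : gamma A) :
  { r : A & { i : hom (ext o) (ext r) & { p : Elt (y := gbase o) (x := r) (gmap o) i unt &
    { q : Elt (y := r) (x := gbase o) i (gmap o) unt |
      IsIdentity i /\ lcomp q p = eid i /\ lcomp p q = eid (gmap o) } } } }.
Proof.
  have H : exists r (i : hom (ext o) (ext r)) (p : Elt (y := gbase o) (x := r) (gmap o) i unt)
    (q : Elt (y := r) (x := gbase o) i (gmap o) unt),
    IsIdentity i /\ lcomp q p = eid i /\ lcomp p q = eid (gmap o).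
  { case: o => x Y f /=; have [r [e]] := fibA x Y f; subst Y => -[p [q [qp pq]]].
    exists r, (idm (ext r)), p, q; split; [exact: IsIdentity_idm | split; last exact: pq].
    rewrite qp; apply: OverEq_eq; exact: OverEq_sym (eid_idm r). }
  (* [IsFibration] is a mere existence; the axiom of choice turns it into data, as the object map of
     a functor requires. *)
  have [r /constructive_indefinite_description [i]] := constructive_indefinite_description _ H.
  move=> /constructive_indefinite_description [p].
  move=> /constructive_indefinite_description [q h].
  by exists r, i, p, q.
Qed.

Lemma gamma_retract (A : VCategory V) : IsFibration A ->
  exists r : VFunctor (gamma A) A,
    Indexed r /\ inhabited (Iso (C := VFunctors (gamma A) A) r (gamma_counit A)).
Proof.
  move=> fibA.
  pose g o := projT1 (restriction_choice fibA o).
  pose i o := projT1 (projT2 (restriction_choice fibA o)).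
  pose p o := projT1 (projT2 (projT2 (restriction_choice fibA o))).
  pose q o := proj1_sig (projT2 (projT2 (projT2 (restriction_choice fibA o)))).
  have hi o : IsIdentity (i o) /\ lcomp (q o) (p o) = eid (i o) /\ lcomp (p o) (q o) = eid (gmap o).
  { exact: (proj2_sig (projT2 (projT2 (projT2 (restriction_choice fibA o))))). }
  pose qp o := proj1 (proj2 (hi o)); pose pq o := proj2 (proj2 (hi o)).
  (* The extent maps of the transported functor are the [i o], which are identities. *)
  exists (@transport _ _ (gamma_counit A) g i p q qp pq); split.
  { by move=> o; exact: (proj1 (hi o)). }
  constructor; exact: transport_iso.
Qed.
End Transport.

Theorem theorem6p10 (S : FinProdCategory) (V : IndexedMonoidalCategory S) :
  exists (Γ : TwoFunctor (VCAT V) (VFIB V)) (adj : TwoAdjunction (VFIB_inclusion V) Γ),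
    (forall A : VFIB V, IsInternalEquivalence (adj_unit adj A)) /\
    (forall B : VCAT V, IsInternalEquivalence (adj_counit adj B)) /\
    IsBiequivalence adj.
Proof.
  exact: (@coreflection_biequivalence (VCAT V) (@IsFibration S V) (@Indexed S V) (@indexed_id S V)
    (@indexed_comp S V) (@gamma S V) (@gamma_fibration S V) (@gamma_counit S V)
    (@gamma_whisker_inv S V) (@gamma_whisker_invK S V) (@gamma_whiskerK S V)
    (@gamma_lift S V) (@gamma_lift_indexed S V) (@gamma_counit_lift S V)
    (@gamma_lift_counit S V) (@gamma_retract S V)).
Qed.
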